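(* Let $H=C_1\xrightarrow{(0,1)}C_1,F_{(0,2)}$. Then $L(H)$ is Wadge complete for the class of deterministic $\Delta^0_3$ tree languages: $L(H)\in\Delta^0_3$, and for every deterministic parity tree automaton $A$ with $L(A)\in\Delta^0_3$ we have $L(A)\le_W L(H)$.
   Context: Deterministic parity tree automata: total $\delta:Q\times\Sigma\to Q\times Q$; accepted iff on every path of the run the highest rank seen infinitely often is even. $\top$: all-accepting state (even rank, $\top\xrightarrow{\sigma}\top,\top$); $\bot$: all-rejecting. Extending an automaton to a larger alphabet: new letters lead from $\bot$ to $\bot,\bot$ and from every other state to $\top,\top$. Canonical flower $F_{(\iota,\kappa)}$ ($\iota\le\kappa$): alphabet $\{a_\iota,\dots,a_\kappa\}$, states $q_\iota,\dots,q_\kappa$ (initial $q_\iota$, $\mathrm{rank}(q_i)=i$) and $\top$, transitions $q_\iota\xrightarrow{a_\iota}q_\iota,\top$; $q_\iota\xrightarrow{a_j}q_j,\top$, $q_j\xrightarrow{a_j}q_\iota,\top$ and $q_j\xrightarrow{a_k}\top,\top$ ($k\ne j$) for $\iota<j\le\kappa$. $C_1=F_{(0,0)}$. $(\iota,\kappa)$-replication $A\xrightarrow{(\iota,\kappa)}A_\iota,\dots,A_\kappa$: take a copy of $F_{(\iota,\kappa)}$ and disjoint copies of $A,A_\iota,\dots,A_\kappa$, all extended to the union of their alphabets together with $\{a_\iota,\dots,a_\kappa,b\}$ ($b$ fresh); replace $q_\iota\xrightarrow{b}\top,\top$ by $q_\iota\xrightarrow{b}q_0^A,\top$, and for each $i=\iota,\dots,\kappa$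 replace the right target $\top$ of the transition of $q_\iota$ on $a_i$ by the initial state of $A_i$. $\Delta^0_3=\Sigma^0_3\cap\Pi^0_3$ in the tree space $T_\Sigma$ with metric $d(s,t)=2^{-\min\{|x|:s(x)\ne t(x)\}}$; $\le_W$ is continuous reducibility. *)

(* Defs.v *)
From Stdlib Require Import List Arith PeanoNat FinFun.
Import ListNotations.

(* A node is a finite word over {false (= left), true (= right)}, read from
   the root. A Sigma-labelled tree is a total labelling of all nodes. *)
Definition tree (S : Type) := list bool -> S.

Record DPTA := {
  alph : Type;
  st : Type;
  alph_fin : Finite alph;
  st_fin : Finite st;
  init : st;
  delta : st -> alph -> st * st;
  rank : st -> nat
}.

Definition subtree {S} (t : tree S) (d : bool) : tree S := fun y => t (d :: y).

Fixpoint run_from (A : DPTA) (q : st A) (t : tree (alph A)) (x : list bool)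
  : st A :=
  match x with
  | [] => q
  | d :: x' =>
      let qs := delta A q (t []) in
      run_from A (if d then snd qs else fst qs) (subtree t d) x'
  end.

Definition run (A : DPTA) (t : tree (alph A)) : list bool -> st A :=
  run_from A (init A) t.

Fixpoint prefix (p : nat -> bool) (n : nat) : list bool :=
  match n with
  | 0 => []
  | S n' => p 0 :: prefix (fun k => p (S k)) n'
  end.

Definition inf_often (P : nat -> Prop) : Prop :=
  forall N, exists n, N <= n /\ P n.

Definition parity_ok (rk : nat -> nat) : Prop :=
  exists m, Nat.Even m /\ inf_often (fun n => rk n = m) /\
    (forall m', inf_often (fun n => rk n = m') -> m' <= m).

Definition accepts (A : DPTA) (t : tree (alph A)) : Prop :=
  forall p : nat -> bool,
    parity_ok (fun n => rank A (run A t (prefix p n))).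

Definition L (A : DPTA) : tree (alph A) -> Prop := fun t => accepts A t.

(** * Topology of T_Sigma (d(s,t) = 2^{-min{|x| : s x <> t x}}) *)
(* d(s,t) <= 2^{-n} iff s and t agree on all nodes of length < n *)
Definition agree_upto {S} (n : nat) (s t : tree S) : Prop :=
  forall x, length x < n -> s x = t x.

Definition compl {S} (X : tree S -> Prop) : tree S -> Prop := fun t => ~ X t.

Definition is_open {S} (U : tree S -> Prop) : Prop :=
  forall t, U t -> exists n, forall s, agree_upto n t s -> U s.

Definition is_closed {S} (X : tree S -> Prop) : Prop := is_open (compl X).

Definition Sigma02 {S} (X : tree S -> Prop) : Prop :=
  exists F : nat -> tree S -> Prop,
    (forall k, is_closed (F k)) /\ (forall t, X t <-> exists k, F k t).
Definition Pi02 {S} (X : tree S -> Prop) : Prop := Sigma02 (compl X).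

Definition Sigma03 {S} (X : tree S -> Prop) : Prop :=
  exists F : nat -> tree S -> Prop,
    (forall k, Pi02 (F k)) /\ (forall t, X t <-> exists k, F k t).
Definition Pi03 {S} (X : tree S -> Prop) : Prop := Sigma03 (compl X).

Definition Delta03 {S} (X : tree S -> Prop) : Prop := Sigma03 X /\ Pi03 X.

Definition continuous {S S'} (f : tree S -> tree S') : Prop :=
  forall t n, exists m, forall s, agree_upto m t s -> agree_upto n (f t) (f s).

Definition wadge_le {S S'} (X : tree S -> Prop) (Y : tree S' -> Prop) : Prop :=
  exists f : tree S -> tree S', continuous f /\ (forall t, X t <-> Y (f t)).

(* Alphabet: union of {a_0} (C_1), {a_0,a_1,a_2} (F_(0,2)) and {a_0,a_1,b}. *)
Inductive HAlph := a0 | a1 | a2 | b.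

(* States: copy of F_(0,1) (Fq0 initial, Fq1, Ftop);
   copy of C_1 for A   (Aq0, Atop);
   copy of C_1 for A_0 (Bq0, Btop);
   copy of F_(0,2) for A_1 (Gq0, Gq1, Gq2, Gtop). *)
Inductive HSt :=
  Fq0 | Fq1 | Ftop | Aq0 | Atop | Bq0 | Btop | Gq0 | Gq1 | Gq2 | Gtop.

Lemma HAlph_fin : Finite HAlph.
Proof. exists [a0; a1; a2; b]. intros []; simpl; tauto. Qed.

Lemma HSt_fin : Finite HSt.
Proof.
  exists [Fq0; Fq1; Ftop; Aq0; Atop; Bq0; Btop; Gq0; Gq1; Gq2; Gtop].
  intros []; simpl; tauto.
Qed.

Definition H_delta (q : HSt) (c : HAlph) : HSt * HSt :=
  match q, c with
  (* flower F_(0,1), extended, with the replication modifications *)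
  | Fq0, a0 => (Fq0, Bq0)      (* right target replaced by init of A_0 *)
  | Fq0, a1 => (Fq1, Gq0)      (* right target replaced by init of A_1 *)
  | Fq0, a2 => (Ftop, Ftop)    (* new letter *)
  | Fq0, b  => (Aq0, Ftop)     (* replaced b-transition *)
  | Fq1, a1 => (Fq0, Ftop)
  | Fq1, _  => (Ftop, Ftop)
  | Ftop, _ => (Ftop, Ftop)
  | Aq0, a0 => (Aq0, Atop)
  | Aq0, _  => (Atop, Atop)
  | Atop, _ => (Atop, Atop)
  | Bq0, a0 => (Bq0, Btop)
  | Bq0, _  => (Btop, Btop)
  | Btop, _ => (Btop, Btop)
  | Gq0, a0 => (Gq0, Gtop)
  | Gq0, a1 => (Gq1, Gtop)
  | Gq0, a2 => (Gq2, Gtop)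
  | Gq0, b  => (Gtop, Gtop)    (* new letter *)
  | Gq1, a1 => (Gq0, Gtop)
  | Gq1, _  => (Gtop, Gtop)
  | Gq2, a2 => (Gq0, Gtop)
  | Gq2, _  => (Gtop, Gtop)
  | Gtop, _ => (Gtop, Gtop)
  end.

Definition H_rank (q : HSt) : nat :=
  match q with
  | Fq1 | Gq1 => 1
  | Gq2 => 2
  | _ => 0
  end.

Definition H : DPTA := {|
  alph := HAlph; st := HSt; alph_fin := HAlph_fin; st_fin := HSt_fin;
  init := Fq0; delta := H_delta; rank := H_rank |}.

(* Main.v *)
(** Call a state flowering if live transitions lead from it to a state with both an
    even loop and an odd loop of larger maximal rank, and say that the automaton [A]
    replicates a flower if some reachable even loop has a side branch into a flowering
    state.

    If [A] replicates a flower, then an infinite sequence of [Sigma02]-complete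
    conditions can be hung along an accepting path, so the set of matrices all of
    whose rows have finitely many ones reduces to [L A]; a Baire category argument
    shows that this set is not [Sigma03].

    Otherwise consider the subtree of flowering nodes of a run.  A path branching
    infinitely often inside it contains a loop with a flowering side branch, hence is
    rejecting; by Koenig's lemma an accepting run branches only finitely often there.
    Off that subtree there are no (0,1)-flowers and acceptance is a Buechi condition,
    which compactness turns into one [Pi02] condition.  So [H] can simulate [A]: its
    main path takes one [a1]-loop, spawning a copy of [F_(0,2)], for the Buechi
    condition and for each odd rank on each of the finitely many paths that remain in
    the flowering subtree. *)

From Stdlib Require Import List Arith PeanoNat Lia FinFun Cantor PArith.
From Stdlib Require Import Classical ClassicalEpsilon.
Require Import Defs.
Import ListNotations.

(** * Booleans for arbitrary propositions *)

Definition dec (P : Prop) : bool :=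
  if excluded_middle_informative P then true else false.

Lemma dec_true (P : Prop) : dec P = true <-> P.
Proof. unfold dec; destruct (excluded_middle_informative P); intuition congruence. Qed.

Lemma dec_false (P : Prop) : dec P = false <-> ~ P.
Proof. unfold dec; destruct (excluded_middle_informative P); intuition congruence. Qed.

Lemma dec_ext (P P' : Prop) : (P <-> P') -> dec P = dec P'.
Proof.
  intros H; destruct (dec P') eqn:E.
  - apply dec_true, H, dec_true, E.
  - apply dec_false; rewrite H; apply dec_false, E.
Qed.

(** * Sequences visiting a property infinitely often *)

Lemma not_inf_often (P : nat -> Prop) :
  ~ inf_often P <-> exists N, forall n, N <= n -> ~ P n.
Proof.
  split.
  - intros H. apply not_all_ex_not in H as [N H]. exists N. intros n Hn HP.
    apply H. exists n; auto.
  - intros [N H] HP. destruct (HP N) as [n [Hn Hp]]. exact (H n Hn Hp).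
Qed.

Lemma inf_often_impl (P P' : nat -> Prop) :
  (forall n, P n -> P' n) -> inf_often P -> inf_often P'.
Proof. intros H HP N. destruct (HP N) as [n [Hn Hp]]; eauto. Qed.

Lemma inf_often_tail (P : nat -> Prop) N :
  inf_often (fun n => P (N + n)) <-> inf_often P.
Proof.
  split; intros H K.
  - destruct (H K) as [n [Hn Hp]]. exists (N + n); split; [lia | auto].
  - destruct (H (N + K)) as [n [Hn Hp]]. exists (n - N); split; [lia |].
    now replace (N + (n - N)) with n by lia.
Qed.

Lemma inf_often_pigeonhole {T} (l : list T) (s : nat -> T) (P : nat -> Prop) :
  inf_often P -> (forall n, P n -> In (s n) l) ->
  exists q, inf_often (fun n => P n /\ s n = q).
Proof.
  revert P. induction l as [|q l IH]; intros P HP Hl.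
  - destruct (HP 0) as [n [_ Hn]]. destruct (Hl n Hn).
  - destruct (classic (inf_often (fun n => P n /\ s n = q))) as [|H]; [eauto|].
    apply not_inf_often in H as [N H].
    destruct (IH (fun n => P n /\ N <= n)) as [q' Hq'].
    + intros K. destruct (HP (Nat.max K N)) as [n [Hn Hp]].
      exists n; repeat split; auto; lia.
    + intros n [Hp Hn]. destruct (Hl n Hp) as [E|]; auto.
      subst. exfalso. apply (H n Hn). auto.
    + exists q'. revert Hq'. apply inf_often_impl. tauto.
Qed.

Lemma uniform_bound (P : nat -> nat -> Prop) N :
  (forall i, i < N -> exists M, forall M', M <= M' -> P i M') ->
  exists M, forall i, i < N -> forall M', M <= M' -> P i M'.
Proof.
  induction N as [|N IH]; intros H.
  - exists 0. intros; lia.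
  - destruct IH as [M HM]; [intros; apply H; lia|].
    destruct (H N) as [M1 HM1]; [lia|].
    exists (Nat.max M M1). intros i Hi M' HM'.
    destruct (Nat.eq_dec i N) as [->|]; [apply HM1; lia | apply HM; lia].
Qed.

Lemma bounded_on_initial (h : nat -> nat) n : exists M, forall k, k <= n -> h k <= M.
Proof.
  destruct (uniform_bound (fun i M => h i <= M) (S n)) as [M HM].
  - intros i _. exists (h i). auto.
  - exists M. intros k Hk. apply HM; lia.
Qed.

(** [m] is the limit superior of [r]. It exists for every bounded sequence, and [parity_ok] then
    only tests its parity. *)
Definition max_inf (r : nat -> nat) (m : nat) : Prop :=
  inf_often (fun n => r n = m) /\ exists N, forall n, N <= n -> r n <= m.

Lemma max_inf_top (r : nat -> nat) m m' :
  max_inf r m -> inf_often (fun n => r n = m') -> m' <= m.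
Proof.
  intros [_ [N HN]] H'. destruct (H' N) as [n [Hn E]]. subst m'. auto.
Qed.

Lemma max_inf_exists (r : nat -> nat) M : (forall n, r n <= M) -> exists m, max_inf r m.
Proof.
  intros HM.
  assert (H : forall k, (exists N, forall n, N <= n -> r n <= k) -> exists m, max_inf r m).
  { induction k as [|k IH]; intros [N HN].
    - exists 0. split; [|eauto]. intros K. exists (Nat.max N K). split; [lia|].
      specialize (HN (Nat.max N K)). lia.
    - destruct (classic (inf_often (fun n => r n = S k))) as [Hi|Hi].
      + exists (S k). split; eauto.
      + apply not_inf_often in Hi as [K HK]. apply IH.
        exists (Nat.max N K). intros n Hn.
        specialize (HN n ltac:(lia)). specialize (HK n ltac:(lia)). lia. }
  apply (H M). exists 0. auto.
Qed.

Lemma parity_ok_max_inf (r : nat -> nat) m : max_inf r m -> (parity_ok r <-> Nat.Even m).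
Proof.
  intros Hm. split.
  - intros [m' [He [Hi Hmax]]].
    assert (m' <= m) by (eapply max_inf_top; eauto).
    assert (m <= m') by (apply Hmax, Hm).
    now replace m with m' by lia.
  - intros He. exists m. repeat split; [auto | apply Hm |].
    intros m' Hm'. eapply max_inf_top; eauto.
Qed.

Lemma parity_ok_tail (r : nat -> nat) N : parity_ok (fun n => r (N + n)) <-> parity_ok r.
Proof.
  unfold parity_ok. split; intros [m [He [Hi Hm]]]; exists m; repeat split; auto.
  - now apply (inf_often_tail (fun n => r n = m)) in Hi.
  - intros m' Hm'. apply Hm. now apply (inf_often_tail (fun n => r n = m')).
  - now apply (inf_often_tail (fun n => r n = m)).
  - intros m' Hm'. apply Hm. now apply (inf_often_tail (fun n => r n = m')) in Hm'.
Qed.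

Lemma parity_ok_ext (r r' : nat -> nat) : (forall n, r n = r' n) -> parity_ok r -> parity_ok r'.
Proof.
  intros E [m [He [Hi Hm]]]. exists m. repeat split; auto.
  - revert Hi. apply inf_often_impl. intros n. now rewrite E.
  - intros m' Hm'. apply Hm. revert Hm'. apply inf_often_impl. intros n. now rewrite E.
Qed.

Lemma parity_ok_upto_2 (r : nat -> nat) :
  (forall n, r n <= 2) ->
  (parity_ok r <-> inf_often (fun n => r n = 2) \/ ~ inf_often (fun n => r n = 1)).
Proof.
  intros H2. destruct (max_inf_exists r 2 H2) as [m Hm].
  rewrite (parity_ok_max_inf r m Hm).
  assert (Hle : m <= 2). { destruct Hm as [Hi _]. destruct (Hi 0) as [n [_ E]]. specialize (H2 n). lia. }
  split.
  - intros He. destruct (Nat.eq_dec m 2) as [->|]; [left; apply Hm|].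
    right. intros H1. assert (1 <= m) by (eapply max_inf_top; eauto).
    replace m with 1 in He by lia. destruct He; lia.
  - intros [Hi|Hi].
    + assert (2 <= m) by (eapply max_inf_top; eauto). replace m with 2 by lia. now exists 1.
    + destruct (Nat.eq_dec m 1) as [->|]; [destruct Hi; apply Hm|].
      destruct (Nat.eq_dec m 0) as [->|]; [now exists 0|]. exists 1; lia.
Qed.

(** * Paths and runs *)

Lemma prefix_length p n : length (prefix p n) = n.
Proof. revert p; induction n; simpl; auto. Qed.

Lemma prefix_ext p p' n : (forall k, k < n -> p k = p' k) -> prefix p n = prefix p' n.
Proof.
  revert p p'. induction n as [|n IH]; simpl; intros p p' H; auto.
  f_equal; [apply H; lia | apply IH; intros; apply H; lia].
Qed.

Lemma prefix_add p n m : prefix p (n + m) = prefix p n ++ prefix (fun k => p (n + k)) m.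
Proof. revert p; induction n as [|n IH]; simpl; intros p; auto. now rewrite IH. Qed.

Lemma prefix_S p n : prefix p (S n) = prefix p n ++ [p n].
Proof.
  replace (S n) with (n + 1) by lia. rewrite prefix_add. simpl. now rewrite Nat.add_0_r.
Qed.

Definition app_path (x : list bool) (p : nat -> bool) (n : nat) : bool :=
  if n <? length x then nth n x false else p (n - length x).

Lemma prefix_app_path x p n : prefix (app_path x p) (length x + n) = x ++ prefix p n.
Proof.
  rewrite prefix_add. f_equal.
  - clear n. induction x as [|d x IH]; simpl; auto. f_equal. exact IH.
  - apply prefix_ext. intros k _. unfold app_path.
    replace (length x + k <? length x) with false by (symmetry; apply Nat.ltb_ge; lia).
    f_equal; lia.
Qed.

Lemma path_through (y : nat -> list bool) (d : nat -> bool) :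
  (forall j, y (S j) = y j ++ [d j]) ->
  exists p, forall j, prefix p (length (y 0) + j) = y j.
Proof.
  intros H. exists (app_path (y 0) d). intros j. rewrite prefix_app_path.
  induction j as [|j IH].
  - simpl. apply app_nil_r.
  - now rewrite prefix_S, app_assoc, IH, H.
Qed.

(** Only the greedy descent is done here. Compactness, namely that a node with witnesses at all
    levels has a child with witnesses at all levels, is argued at each application. *)
Lemma koenig (P : list bool -> Prop) :
  P [] -> (forall x, P x -> exists d, P (x ++ [d])) ->
  exists p, forall n, P (prefix p n).
Proof.
  intros H0 HS.
  set (next := fun x => epsilon (inhabits false) (fun d => P (x ++ [d]))).
  set (y := fix y n := match n with 0 => [] | S n => y n ++ [next (y n)] end).
  destruct (path_through y (fun n => next (y n)) (fun _ => eq_refl)) as [p Hp].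
  exists p. intros n. specialize (Hp n). simpl in Hp. rewrite Hp. clear Hp.
  induction n as [|n IH]; simpl; auto.
  unfold next. apply epsilon_spec. auto.
Qed.

Definition target (A : DPTA) (q : st A) (s : alph A * bool) : st A :=
  if snd s then snd (delta A q (fst s)) else fst (delta A q (fst s)).

Definition subtree_at {S} (t : tree S) (x : list bool) : tree S := fun y => t (x ++ y).

Lemma run_from_app A q t x y :
  run_from A q t (x ++ y) = run_from A (run_from A q t x) (subtree_at t x) y.
Proof. revert q t; induction x as [|d x IH]; simpl; intros q t; auto. Qed.

Lemma run_from_ext A q t s x :
  (forall y, length y < length x -> t y = s y) -> run_from A q t x = run_from A q s x.
Proof.
  revert q t s; induction x as [|d x IH]; intros q t s H; auto.
  cbn [run_from]. rewrite (H []) by (simpl; lia). apply IH. intros y Hy. apply H. simpl; lia.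
Qed.

Lemma run_from_snoc A q t x d :
  run_from A q t (x ++ [d]) = target A (run_from A q t x) (t x, d).
Proof. rewrite run_from_app. simpl. unfold subtree_at. now rewrite app_nil_r. Qed.

Lemma run_from_prefix_S A q t p n :
  run_from A q t (prefix p (S n)) =
  target A (run_from A q t (prefix p n)) (t (prefix p n), p n).
Proof. rewrite prefix_S. apply run_from_snoc. Qed.

Lemma run_prefix_S A t p n :
  run A t (prefix p (S n)) = target A (run A t (prefix p n)) (t (prefix p n), p n).
Proof. apply run_from_prefix_S. Qed.

Definition accepts_from (A : DPTA) (q : st A) (t : tree (alph A)) : Prop :=
  forall p, parity_ok (fun n => rank A (run_from A q t (prefix p n))).

Lemma accepts_from_subtree A q t x :
  accepts_from A q t -> accepts_from A (run_from A q t x) (subtree_at t x).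
Proof.
  intros H p. specialize (H (app_path x p)).
  apply (parity_ok_tail _ (length x)) in H. revert H. apply parity_ok_ext.
  intros n. now rewrite prefix_app_path, run_from_app.
Qed.

Lemma rank_bounded (A : DPTA) : exists M, forall q, rank A q <= M.
Proof.
  destruct (st_fin A) as [l Hl]. exists (list_max (map (rank A) l)). intros q.
  assert (H := proj1 (list_max_le (map (rank A) l) _) (le_n _)).
  rewrite Forall_forall in H. apply H, in_map, Hl.
Qed.

Lemma inf_often_state (A : DPTA) (s : nat -> st A) (P : nat -> Prop) :
  inf_often P -> exists q, inf_often (fun n => P n /\ s n = q).
Proof.
  intros HP. destruct (st_fin A) as [l Hl]. eapply inf_often_pigeonhole; eauto.
Qed.

(** * Finite paths, loops and flowers *)

Definition productive (A : DPTA) (q : st A) : Prop := exists t, accepts_from A q t.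

Lemma productive_subtree A q t x : accepts_from A q t -> productive A (run_from A q t x).
Proof. intros H. exists (subtree_at t x). now apply accepts_from_subtree. Qed.

Fixpoint walk (A : DPTA) (q : st A) (w : list (alph A * bool)) : st A :=
  match w with [] => q | s :: w' => walk A (target A q s) w' end.

Fixpoint ranks (A : DPTA) (q : st A) (w : list (alph A * bool)) : list nat :=
  match w with [] => [] | s :: w' => rank A (target A q s) :: ranks A (target A q s) w' end.

(** Both successors must be productive at every step, so that accepted trees can be hung off the
    word. *)
Fixpoint live (A : DPTA) (q : st A) (w : list (alph A * bool)) : Prop :=
  match w with
  | [] => True
  | s :: w' => (forall d, productive A (target A q (fst s, d))) /\ live A (target A q s) w'
  end.

(** [ranks] lists the ranks reached after each letter, so that the membership of [m] forces [w] to
    be nonempty. *)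
Definition loop (A : DPTA) (q : st A) (m : nat) (w : list (alph A * bool)) : Prop :=
  live A q w /\ walk A q w = q /\ In m (ranks A q w) /\ (forall r, In r (ranks A q w) -> r <= m).

Definition flower (A : DPTA) (q : st A) : Prop :=
  exists m0 m1 w0 w1, Nat.Even m0 /\ Nat.Odd m1 /\ m0 < m1 /\ loop A q m0 w0 /\ loop A q m1 w1.

Definition flowering (A : DPTA) (q : st A) : Prop :=
  exists w, live A q w /\ flower A (walk A q w).

Definition flip (A : DPTA) (s : alph A * bool) : alph A * bool := (fst s, negb (snd s)).

(* An accepting loop that can spawn, at each turn, a state from which a
   (0,1)-flower is reachable: the pattern responsible for Pi^0_3-hardness. *)
Definition replicates_flower (A : DPTA) : Prop :=
  exists u m w1 s w2, live A (init A) u /\ Nat.Even m /\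
    loop A (walk A (init A) u) m (w1 ++ s :: w2) /\
    flowering A (target A (walk A (walk A (init A) u) w1) (flip A s)).

Lemma live_app A q w w' : live A q (w ++ w') <-> live A q w /\ live A (walk A q w) w'.
Proof. revert q; induction w; simpl; intros; [tauto|]. rewrite IHw. tauto. Qed.

Lemma flowering_parent A q a d :
  (forall d, productive A (target A q (a, d))) ->
  flowering A (target A q (a, d)) -> flowering A q.
Proof. intros H [w [Hw Hf]]. exists ((a, d) :: w). simpl. auto. Qed.

Fixpoint segment {T} (t : tree T) (p : nat -> bool) (i n : nat) : list (T * bool) :=
  match n with 0 => [] | S n' => (t (prefix p i), p i) :: segment t p (S i) n' end.

Lemma segment_add {T} (t : tree T) p i n m :
  segment t p i (n + m) = segment t p i n ++ segment t p (i + n) m.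
Proof.
  revert i; induction n as [|n IH]; simpl; intros i.
  - now rewrite Nat.add_0_r.
  - now rewrite IH, Nat.add_succ_r.
Qed.

Lemma walk_segment A t p i n :
  walk A (run A t (prefix p i)) (segment t p i n) = run A t (prefix p (i + n)).
Proof.
  revert i; induction n as [|n IH]; intros i; cbn [segment walk].
  - now rewrite Nat.add_0_r.
  - unfold run in *. rewrite <- run_from_prefix_S, IH. now rewrite Nat.add_succ_r.
Qed.

Lemma ranks_segment A t p i n r :
  In r (ranks A (run A t (prefix p i)) (segment t p i n)) <->
  exists k, i < k <= i + n /\ r = rank A (run A t (prefix p k)).
Proof.
  revert i; induction n as [|n IH]; intros i; cbn [segment ranks In].
  - split; [tauto | intros [k Hk]; lia].
  - unfold run in *. rewrite <- run_from_prefix_S, IH. split.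
    + intros [E|[k [Hk E]]].
      * exists (S i). split; [lia | auto].
      * exists k. split; [lia | auto].
    + intros [k [Hk E]]. destruct (Nat.eq_dec k (S i)) as [->|]; auto.
      right. exists k. split; [lia | auto].
Qed.

Lemma live_segment A t p i n :
  (forall x, productive A (run A t x)) ->
  live A (run A t (prefix p i)) (segment t p i n).
Proof.
  intros H. revert i; induction n as [|n IH]; intros i; cbn [segment live]; auto.
  split.
  - intros d. cbn [fst]. unfold run. rewrite <- run_from_snoc. apply H.
  - unfold run in *. rewrite <- run_from_prefix_S. apply IH.
Qed.

Lemma segment_loop A t p i j k m :
  (forall x, productive A (run A t x)) ->
  i < k <= j -> run A t (prefix p i) = run A t (prefix p j) ->
  rank A (run A t (prefix p k)) = m ->
  (forall n, i <= n -> rank A (run A t (prefix p n)) <= m) ->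
  loop A (run A t (prefix p i)) m (segment t p i (j - i)).
Proof.
  intros Hp Hk E Hm Hmax. split; [|split; [|split]].
  - now apply live_segment.
  - rewrite walk_segment. now replace (i + (j - i)) with j by lia.
  - apply ranks_segment. exists k. split; [lia | auto].
  - intros r Hr. apply ranks_segment in Hr as [n [Hn ->]]. apply Hmax. lia.
Qed.

(** * Borel classes *)

Lemma run_agree A n t s x :
  agree_upto n t s -> length x <= n -> run A t x = run A s x.
Proof. intros H Hx. apply run_from_ext. intros y Hy. apply H. lia. Qed.

Lemma Pi02_intro {S} (X : tree S -> Prop) (O : nat -> tree S -> Prop) :
  (forall a, is_open (O a)) -> (forall t, X t <-> forall a, O a t) -> Pi02 X.
Proof.
  intros HO HX. exists (fun a => compl (O a)). split.
  - intros a t Ht. apply NNPP in Ht. destruct (HO a t Ht) as [n Hn].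
    exists n. intros s Hs Hc. exact (Hc (Hn s Hs)).
  - intros t. unfold compl. rewrite HX. split.
    + apply not_all_ex_not.
    + intros [a Ha] H. auto.
Qed.

Lemma Pi02_elim {S} (X : tree S -> Prop) :
  Pi02 X -> exists O : nat -> tree S -> Prop,
    (forall a, is_open (O a)) /\ (forall t, X t <-> forall a, O a t).
Proof.
  intros [F [HF HX]]. exists (fun a => compl (F a)). split; [exact HF|].
  intros t. specialize (HX t). unfold compl in *. split.
  - intros Ht a Ha. destruct (proj2 HX) ; eauto.
  - intros H. apply NNPP. intros Hn. destruct (proj1 HX Hn) as [a Ha]. exact (H a Ha).
Qed.

Lemma open_union {S T} (R : T -> tree S -> Prop) :
  (forall i, is_open (R i)) -> is_open (fun t => exists i, R i t).
Proof.
  intros H t [i Hi]. destruct (H i t Hi) as [n Hn]. exists n. intros s Hs. eauto.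
Qed.

(** * Coding finite words by natural numbers *)

(** Dropping the leading one of the binary expansion makes positive numbers correspond bijectively
    to finite words, lowest bit first. *)
Fixpoint word_of_pos (p : positive) : list bool :=
  match p with
  | xH => []
  | xO p => false :: word_of_pos p
  | xI p => true :: word_of_pos p
  end.

Fixpoint pos_of_word (x : list bool) : positive :=
  match x with
  | [] => xH
  | false :: x => xO (pos_of_word x)
  | true :: x => xI (pos_of_word x)
  end.

Lemma word_of_pos_of_word x : word_of_pos (pos_of_word x) = x.
Proof. induction x as [|[] x IH]; simpl; congruence. Qed.

Definition word_of_nat (n : nat) : list bool := word_of_pos (Pos.of_succ_nat n).
Definition nat_of_word (x : list bool) : nat := pred (Pos.to_nat (pos_of_word x)).

Lemma word_of_nat_of_word x : word_of_nat (nat_of_word x) = x.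
Proof.
  unfold word_of_nat, nat_of_word. rewrite <- (word_of_pos_of_word x) at 2. f_equal.
  rewrite Pos.of_nat_succ, Nat.succ_pred; [apply Pos2Nat.id|].
  pose proof (Pos2Nat.is_pos (pos_of_word x)). lia.
Qed.

Definition decode (k : nat) : list bool * nat :=
  (word_of_nat (fst (of_nat k)), snd (of_nat k)).
Definition encode (x : list bool) (m : nat) : nat := to_nat (nat_of_word x, m).

Lemma decode_encode x m : decode (encode x m) = (x, m).
Proof. unfold decode, encode. rewrite cancel_of_to. simpl. now rewrite word_of_nat_of_word. Qed.

Lemma pos_of_word_of_pos p : pos_of_word (word_of_pos p) = p.
Proof. induction p; simpl; congruence. Qed.

Lemma encode_decode k : encode (fst (decode k)) (snd (decode k)) = k.
Proof.
  unfold decode, encode, nat_of_word, word_of_nat. cbn [fst snd].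
  rewrite pos_of_word_of_pos, SuccNat2Pos.id_succ. cbn [pred].
  rewrite <- surjective_pairing. apply cancel_to_of.
Qed.

Lemma encode_bounded N M :
  exists K, forall x m, length x <= N -> m <= M -> encode x m <= K.
Proof.
  assert (H : exists l : list (list bool), forall x, length x <= N -> In x l).
  { induction N as [|N [l IH]].
    - exists [[]]. intros [|] Hx; simpl in *; [auto | lia].
    - exists ([] :: map (cons false) l ++ map (cons true) l).
      intros [|d x] Hx; [now left|]. right. apply in_app_iff. simpl in Hx.
      destruct d; [right | left]; apply in_map, IH; lia. }
  destruct H as [l Hl].
  exists (list_max (map (fun xm => encode (fst xm) (snd xm)) (list_prod l (seq 0 (S M))))).
  intros x m Hx Hm.
  assert (H := proj1 (list_max_le (map (fun xm => encode (fst xm) (snd xm))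
                 (list_prod l (seq 0 (S M)))) _) (le_n _)).
  rewrite Forall_forall in H. apply H.
  apply (in_map (fun xm => encode (fst xm) (snd xm)) _ (x, m)).
  apply in_prod; auto. apply in_seq. lia.
Qed.

(** * The language of [H] *)

Definition left_path (n : nat) : bool := false.
Definition branch_path (n k : nat) : bool := k =? n.

(** From these states only rank 0 is ever seen: besides the all-accepting states they comprise the
    two copies of [C_1]. *)
Definition settled (q : HSt) : Prop :=
  match q with Ftop | Aq0 | Atop | Bq0 | Btop | Gtop => True | _ => False end.

Definition side (q : HSt) : Prop :=
  match q with Fq0 | Fq1 => False | _ => True end.

Lemma settled_rank q : settled q -> H_rank q = 0.
Proof. destruct q; simpl; tauto. Qed.

Lemma settled_step q s : settled q -> settled (target H q s).
Proof. destruct s as [[] []]; destruct q; simpl; tauto. Qed.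

Lemma side_step_right q a : settled q \/ side q -> settled (target H q (a, true)).
Proof. destruct a; destruct q; simpl; tauto. Qed.

Lemma side_step q s : side q -> side (target H q s).
Proof. destruct s as [[] []]; destruct q; simpl; tauto. Qed.

Lemma step_right q a : side (target H q (a, true)).
Proof. destruct a; destruct q; simpl; tauto. Qed.

Lemma H_rank_le_2 q : rank H q <= 2.
Proof. destruct q; simpl; lia. Qed.

Lemma H_run_keeps (P : HSt -> Prop) (t : tree HAlph) p n :
  (forall q s, P q -> P (target H q s)) -> P (run H t (prefix p n)) ->
  forall k, n <= k -> P (run H t (prefix p k)).
Proof.
  intros HP Hn k Hk. induction Hk as [|k Hk IH]; auto.
  rewrite run_prefix_S. apply HP, IH.
Qed.

Lemma H_left_state (t : tree HAlph) n :
  run H t (prefix left_path n) = Fq0 \/ run H t (prefix left_path n) = Fq1 \/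
  settled (run H t (prefix left_path n)).
Proof.
  induction n as [|n IH]; [now left|].
  rewrite run_prefix_S. change (left_path n) with false.
  destruct (t (prefix left_path n)), (run H t (prefix left_path n));
    simpl in *; intuition congruence.
Qed.

Lemma parity_ok_eventually_zero (r : nat -> nat) N : (forall n, N <= n -> r n = 0) -> parity_ok r.
Proof.
  intros H0. apply (parity_ok_max_inf _ 0); [|now exists 0]. split.
  - intros K. exists (Nat.max N K). split; [lia | apply H0; lia].
  - exists N. intros n Hn. rewrite H0; auto.
Qed.

Definition H_rank_at (t : tree HAlph) (p : nat -> bool) (n : nat) : nat :=
  H_rank (run H t (prefix p n)).

(** A first right turn leaves the main flower and a second one leads to a settled state, so only
    paths with at most one right turn can be rejecting. *)
Lemma H_accepts_iff (t : tree HAlph) :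
  L H t <-> parity_ok (H_rank_at t left_path) /\ forall n, parity_ok (H_rank_at t (branch_path n)).
Proof.
  split; [intros Ht; split; [|intros n]; apply Ht|].
  intros [H0 H1] p.
  destruct (classic (exists n, p n = true)) as [Hp|Hp].
  2:{ revert H0. apply parity_ok_ext. intros n. unfold H_rank_at.
      change (rank H) with H_rank. do 2 f_equal. apply prefix_ext. intros k _.
      unfold left_path. destruct (p k) eqn:E; auto. exfalso; eauto. }
  assert (Hfirst : exists n, p n = true /\ forall k, k < n -> p k = false).
  { destruct Hp as [n Hn]. induction n as [n IH] using lt_wf_ind.
    destruct (classic (exists k, k < n /\ p k = true)) as [[k [Hk E]]|Hnone]; [eauto|].
    exists n. split; auto. intros k Hk. destruct (p k) eqn:E; auto. exfalso; eauto. }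
  destruct Hfirst as [n [Hn Hlt]].
  destruct (classic (exists k, n < k /\ p k = true)) as [[k [Hk Ek]]|Hnone].
  - apply (parity_ok_eventually_zero _ (S k)). intros j Hj. apply settled_rank.
    apply (H_run_keeps settled t p (S k)); auto using settled_step.
    rewrite run_prefix_S, Ek. apply side_step_right. right.
    apply (H_run_keeps side t p (S n)); auto using side_step.
    rewrite run_prefix_S, Hn. apply step_right.
  - generalize (H1 n). apply parity_ok_ext. intros j. unfold H_rank_at.
    change (rank H) with H_rank. do 2 f_equal. apply prefix_ext. intros k _.
    unfold branch_path. destruct (lt_eq_lt_dec k n) as [[Hk| ->]|Hk].
    + rewrite Hlt by auto. apply Nat.eqb_neq. lia.
    + now rewrite Hn, Nat.eqb_refl.
    + destruct (p k) eqn:E; [exfalso; eauto|]. apply Nat.eqb_neq. lia.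
Qed.

(** Rank 2 occurs only in the copy of [F_(0,2)], which is entered by a right turn. *)
Lemma H_left_parity (t : tree HAlph) :
  parity_ok (H_rank_at t left_path) <-> ~ inf_often (fun n => H_rank_at t left_path n = 1).
Proof.
  rewrite parity_ok_upto_2 by (intros; apply H_rank_le_2).
  split; [|now right]. intros [H2|]; auto. exfalso.
  destruct (H2 0) as [n [_ E]]. unfold H_rank_at in E.
  destruct (H_left_state t n) as [E'|[E'|E']]; [| |rewrite settled_rank in E by auto];
    try rewrite E' in E; discriminate.
Qed.

Definition branch_ok (t : tree HAlph) (n : nat) : Prop :=
  inf_often (fun k => H_rank_at t (branch_path n) k = 2) \/
  ~ inf_often (fun k => H_rank_at t (branch_path n) k = 1).

Lemma H_language (t : tree HAlph) :
  L H t <-> ~ inf_often (fun n => H_rank_at t left_path n = 1) /\ forall n, branch_ok t n.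
Proof.
  rewrite H_accepts_iff, H_left_parity.
  split; intros [H0 H1]; split; auto; intros n; specialize (H1 n);
    apply parity_ok_upto_2; auto; intros; apply H_rank_le_2.
Qed.

Lemma prefix_branch_before n k : k <= n -> prefix (branch_path n) k = prefix left_path k.
Proof. intros Hk. apply prefix_ext. intros j Hj. apply Nat.eqb_neq. lia. Qed.

(** A right turn enters the copy of [F_(0,2)] only where [Fq0] reads [a1], and this puts [Fq1], of
    rank 1, next on the leftmost path. Beyond the last such place every right turn settles. *)
Lemma no_rank_1_on_branch (t : tree HAlph) N n :
  (forall k, N <= k -> H_rank_at t left_path k <> 1) -> N <= n ->
  forall k, N <= k -> H_rank_at t (branch_path n) k <> 1.
Proof.
  intros HN Hn k Hk. destruct (le_gt_dec k n) as [Hkn|Hkn].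
  - unfold H_rank_at. rewrite prefix_branch_before by auto. now apply HN.
  - unfold H_rank_at. rewrite settled_rank; [discriminate|].
    apply (H_run_keeps settled t _ (S n)); auto using settled_step.
    generalize (HN n Hn), (HN (S n) ltac:(lia)), (H_left_state t n).
    unfold H_rank_at. rewrite !run_prefix_S, prefix_branch_before by auto.
    change (left_path n) with false. replace (branch_path n n) with true
      by (symmetry; apply Nat.eqb_refl).
    destruct (t (prefix left_path n)), (run H t (prefix left_path n));
      simpl; intuition congruence.
Qed.

(** * The Borel complexity of [L H] *)

Lemma H_rank_at_local n p k :
  forall (t s : tree HAlph), agree_upto n t s -> k <= n -> H_rank_at t p k = H_rank_at s p k.
Proof.
  intros t s Hs Hk. unfold H_rank_at. f_equal. apply (run_agree H n); auto.
  now rewrite prefix_length.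
Qed.

(** A finite word [c] is guessed. Its length bounds the visits to rank 1 on the leftmost path, which
    leaves only the branches below that length to be checked. Bit [n] tells whether branch [n] sees
    rank 2 infinitely often or is free of rank 1 from [length c] on. Each guess is checked by a
    [Pi02] condition. *)
Lemma L_H_Sigma03 : Sigma03 (L H).
Proof.
  exists (fun i t => let c := word_of_nat i in
    (forall k, length c <= k -> H_rank_at t left_path k <> 1) /\
    forall n, n < length c ->
      if nth n c false then inf_often (fun k => H_rank_at t (branch_path n) k = 2)
      else forall k, length c <= k -> H_rank_at t (branch_path n) k <> 1).
  split.
  - intros i. cbv zeta. set (c := word_of_nat i).
    apply (Pi02_intro _ (fun a t => exists k,
      (length c <= fst (of_nat a) -> H_rank_at t left_path (fst (of_nat a)) <> 1) /\
      (snd (of_nat a) < length c ->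
        if nth (snd (of_nat a)) c false
        then fst (of_nat a) <= k /\ H_rank_at t (branch_path (snd (of_nat a))) k = 2
        else length c <= fst (of_nat a) ->
             H_rank_at t (branch_path (snd (of_nat a))) (fst (of_nat a)) <> 1))).
    + intros a. apply open_union. intros k t Ht.
      exists (Nat.max k (fst (of_nat a))). intros s Hs.
      assert (E : forall p j, j <= Nat.max k (fst (of_nat a)) ->
                H_rank_at s p j = H_rank_at t p j)
        by (intros; symmetry; eapply H_rank_at_local; eauto).
      rewrite !E by lia. exact Ht.
    + intros t. split.
      * intros [H1 H2] a. destruct (of_nat a) as [j n]. cbn [fst snd].
        destruct (le_gt_dec (length c) n) as [Hn|Hn].
        { exists 0. split; auto. lia. }
        specialize (H2 n Hn). destruct (nth n c false).
        -- destruct (H2 j) as [k Hk]. exists k. auto.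
        -- exists 0. auto.
      * intros Ha. split.
        -- intros k Hk. destruct (Ha (to_nat (k, 0))) as [_ [H1 _]].
           rewrite cancel_of_to in H1. auto.
        -- intros n Hn. destruct (nth n c false) eqn:E.
           ++ intros j. destruct (Ha (to_nat (j, n))) as [k [_ H1]].
              rewrite cancel_of_to in H1. cbn [fst snd] in H1. rewrite E in H1. eauto.
           ++ intros j Hj. destruct (Ha (to_nat (j, n))) as [k [_ H1]].
              rewrite cancel_of_to in H1. cbn [fst snd] in H1. rewrite E in H1. auto.
  - intros t. rewrite H_language. split.
    + intros [H0 H1]. apply not_inf_often in H0 as [N0 HN0].
      destruct (uniform_bound (fun n M =>
        inf_often (fun k => H_rank_at t (branch_path n) k = 2) \/
        forall k, M <= k -> H_rank_at t (branch_path n) k <> 1) N0) as [M HM].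
      { intros n _. destruct (H1 n) as [H2|H2]; [exists 0; auto|].
        apply not_inf_often in H2 as [M HM]. exists M. intros M' HM'. right.
        intros k Hk. apply HM. lia. }
      (* The bound must serve the leftmost path and the branches below [N0]; the branches from [N0]
         on are covered by [no_rank_1_on_branch]. *)
      set (N := Nat.max N0 M).
      set (c := map (fun n => dec (inf_often (fun k => H_rank_at t (branch_path n) k = 2)))
                    (seq 0 N)).
      assert (Hc : length c = N) by (unfold c; now rewrite length_map, length_seq).
      exists (nat_of_word c). cbv zeta. rewrite word_of_nat_of_word, Hc. split.
      * intros k Hk. apply HN0. lia.
      (* The default value is rewritten as an image of the mapped function so that [map_nth]
         applies. *)
      * intros n Hn. rewrite (nth_indep _ false
          (dec (inf_often (fun k => H_rank_at t (branch_path 0) k = 2)))) by lia.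
        unfold c. rewrite (map_nth (fun n => dec (inf_often
           (fun k => H_rank_at t (branch_path n) k = 2)))), seq_nth by auto.
        simpl. destruct (dec _) eqn:E; [now apply dec_true|]. apply dec_false in E.
        intros k Hk. destruct (le_gt_dec N0 n) as [Hn0|Hn0].
        -- apply (no_rank_1_on_branch t N0); auto. lia.
        -- destruct (HM n Hn0 N ltac:(lia)) as [H2|H2]; [contradiction|auto].
    + intros [i Hi]. cbv zeta in Hi. destruct Hi as [H0 H1]. split.
      * apply not_inf_often. eauto.
      * intros n. destruct (le_gt_dec (length (word_of_nat i)) n) as [Hn|Hn].
        -- right. apply not_inf_often. exists (length (word_of_nat i)).
           now apply no_rank_1_on_branch.
        -- specialize (H1 n Hn). destruct (nth n _ false); [now left|].
           right. apply not_inf_often. eauto.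
Qed.

(** Rejection has countably many possible causes, each [Pi02]: rank 1 recurs on the leftmost path,
    or it recurs on a branch [n] that is free of rank 2 from some [N] on. *)
Lemma L_H_Pi03 : Pi03 (L H).
Proof.
  exists (fun i t => match i with
    | 0 => inf_often (fun n => H_rank_at t left_path n = 1)
    | S i => let (n, N) := of_nat i in
        inf_often (fun k => H_rank_at t (branch_path n) k = 1) /\
        forall k, N <= k -> H_rank_at t (branch_path n) k <> 2
    end).
  split.
  - intros [|i].
    + apply (Pi02_intro _ (fun a t => exists k, a <= k /\ H_rank_at t left_path k = 1)).
      * intros a. apply open_union. intros k t Ht. exists k. intros s Hs.
        rewrite <- (H_rank_at_local k _ k t s); auto.
      * reflexivity.
    + destruct (of_nat i) as [n N].
      apply (Pi02_intro _ (fun a t => exists k,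
        (a <= k /\ H_rank_at t (branch_path n) k = 1) /\
        (N <= a -> H_rank_at t (branch_path n) a <> 2))).
      * intros a. apply open_union. intros k t Ht. exists (Nat.max a k). intros s Hs.
        rewrite <- !(H_rank_at_local (Nat.max a k) _ _ t s) by (auto; lia). exact Ht.
      * intros t. split.
        -- intros [H1 H2] a. destruct (H1 a) as [k Hk]. exists k. auto.
        -- intros Ha. split; [intros a|intros a]; destruct (Ha a) as [k [Hk1 Hk2]]; eauto.
  - intros t. unfold compl. rewrite H_language. split.
    + intros Hn. destruct (classic (inf_often (fun n => H_rank_at t left_path n = 1))) as [Hi|Hi].
      { now exists 0. }
      assert (Hb : exists n, ~ branch_ok t n).
      { apply not_all_ex_not. tauto. }
      destruct Hb as [n Hb]. apply not_or_and in Hb as [H2 H1].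
      apply NNPP in H1. apply not_inf_often in H2 as [N HN].
      exists (S (to_nat (n, N))). rewrite cancel_of_to. auto.
    + intros [[|i] Hi] [H0 H1]; [auto|]. destruct (of_nat i) as [n N].
      destruct Hi as [Hi1 Hi2]. destruct (H1 n) as [H2|H2]; [|auto].
      destruct (H2 N) as [k [Hk E]]. exact (Hi2 k Hk E).
Qed.

(** * Trees for [H] coding a list of conditions *)

Definition letter (r : nat) : HAlph := match r with 1 => a1 | 2 => a2 | _ => a0 end.

(* Every letter of [e] and [g] is repeated twice: at even depths the run is in
   a base state [Fq0] or [Gq0], and the rank chosen there shows at the next depth. *)
Fixpoint H_code_from (e : nat -> bool) (g : nat -> nat -> nat) (n : nat) (y : list bool) : HAlph :=
  match y with
  | [] => if e (Nat.div2 n) then a1 else a0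
  | false :: y => H_code_from e g (S n) y
  | true :: y => letter (g (Nat.div2 n) (Nat.div2 (length y)))
  end.

Definition H_code e g : tree HAlph := H_code_from e g 0.

Lemma H_code_prefix_left e g n k y :
  H_code_from e g n (prefix left_path k ++ y) = H_code_from e g (n + k) y.
Proof.
  revert n; induction k as [|k IH]; intros n; simpl; [now rewrite Nat.add_0_r|].
  change (fun k => left_path (S k)) with left_path. now rewrite IH, Nat.add_succ_r.
Qed.

Lemma H_code_left e g k :
  H_code e g (prefix left_path k) = if e (Nat.div2 k) then a1 else a0.
Proof.
  unfold H_code. rewrite <- (app_nil_r (prefix _ _)). now rewrite H_code_prefix_left.
Qed.

Lemma prefix_branch_after n m :
  prefix (branch_path n) (S n + m) = prefix left_path n ++ true :: prefix left_path m.
Proof.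
  replace (S n + m) with (n + S m) by lia. rewrite prefix_add. f_equal.
  - now apply prefix_branch_before.
  - simpl. f_equal.
    + apply Nat.eqb_eq. lia.
    + apply prefix_ext. intros k _. apply Nat.eqb_neq. lia.
Qed.

Lemma H_code_branch e g n m :
  H_code e g (prefix (branch_path n) (S n + m)) = letter (g (Nat.div2 n) (Nat.div2 m)).
Proof.
  rewrite prefix_branch_after. unfold H_code. rewrite H_code_prefix_left. simpl.
  now rewrite prefix_length.
Qed.

Lemma H_code_left_run e g k :
  run H (H_code e g) (prefix left_path (2 * k)) = Fq0 /\
  run H (H_code e g) (prefix left_path (S (2 * k))) = if e k then Fq1 else Fq0.
Proof.
  induction k as [|k [IH1 IH2]].
  - rewrite run_prefix_S, H_code_left. simpl. split; auto. now destruct (e 0).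
  - replace (2 * S k) with (S (S (2 * k))) by lia.
    assert (E : run H (H_code e g) (prefix left_path (S (S (2 * k)))) = Fq0).
    { rewrite run_prefix_S, IH2, H_code_left, Nat.div2_succ_double. now destruct (e k). }
    split; auto. rewrite run_prefix_S, E, H_code_left.
    replace (S (S (2 * k))) with (2 * S k) by lia. rewrite Nat.div2_double.
    now destruct (e (S k)).
Qed.

(** Only [Fq0] reading [a1] spawns a copy of [F_(0,2)]. At odd depths the run is in [Fq1] reading
    [a1] or in [Fq0] reading [a0], and right turns settle. *)
Lemma H_code_unused_branch e g n :
  Nat.Odd n \/ e (Nat.div2 n) = false ->
  settled (run H (H_code e g) (prefix (branch_path n) (S n))).
Proof.
  intros Hn. rewrite run_prefix_S, prefix_branch_before, H_code_left by auto.
  replace (branch_path n n) with true by (symmetry; apply Nat.eqb_refl).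
  destruct (Nat.Even_or_Odd n) as [[k ->]|[k ->]].
  - destruct Hn as [[j Hj]|Hn]; [lia|]. rewrite Hn.
    rewrite (proj1 (H_code_left_run e g k)). exact I.
  - rewrite Nat.add_1_r, Nat.div2_succ_double.
    rewrite (proj2 (H_code_left_run e g k)). destruct (e k); exact I.
Qed.

Lemma H_code_branch_run e g k m :
  e k = true ->
  run H (H_code e g) (prefix (branch_path (2 * k)) (S (2 * k) + 2 * m)) = Gq0 /\
  H_rank_at (H_code e g) (branch_path (2 * k)) (S (S (2 * k) + 2 * m)) =
    match g k m with 1 => 1 | 2 => 2 | _ => 0 end.
Proof.
  intros Ek. assert (Hg : forall m, 
    run H (H_code e g) (prefix (branch_path (2 * k)) (S (2 * k) + 2 * m)) = Gq0 ->
    run H (H_code e g) (prefix (branch_path (2 * k)) (S (S (2 * k) + 2 * m))) =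
      match g k m with 1 => Gq1 | 2 => Gq2 | _ => Gq0 end).
  { clear m. intros m E. rewrite run_prefix_S, E, H_code_branch.
    rewrite !Nat.div2_double.
    replace (branch_path (2 * k) (S (2 * k) + 2 * m)) with false
      by (symmetry; apply Nat.eqb_neq; lia).
    destruct (g k m) as [|[|[|r]]]; reflexivity. }
  assert (Hb : run H (H_code e g) (prefix (branch_path (2 * k)) (S (2 * k) + 2 * m)) = Gq0).
  { induction m as [|m IH].
    - rewrite Nat.mul_0_r, Nat.add_0_r.
      rewrite run_prefix_S, prefix_branch_before, H_code_left by auto.
      replace (branch_path (2 * k) (2 * k)) with true by (symmetry; apply Nat.eqb_refl).
      rewrite Nat.div2_double, Ek. rewrite (proj1 (H_code_left_run e g k)). reflexivity.
    - replace (S (2 * k) + 2 * S m) with (S (S (S (2 * k) + 2 * m))) by lia.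
      specialize (Hg m IH). rewrite run_prefix_S, Hg.
      replace (S (S (2 * k) + 2 * m)) with (S (2 * k) + S (2 * m)) by lia.
      rewrite H_code_branch, Nat.div2_double, Nat.div2_succ_double.
      replace (branch_path (2 * k) (S (2 * k) + S (2 * m))) with false
        by (symmetry; apply Nat.eqb_neq; lia).
      destruct (g k m) as [|[|[|r]]]; reflexivity. }
  split; auto. unfold H_rank_at. rewrite Hg by auto.
  destruct (g k m) as [|[|[|r]]]; reflexivity.
Qed.

Lemma H_code_branch_inf_often e g k r :
  e k = true -> r = 1 \/ r = 2 ->
  (inf_often (fun n => H_rank_at (H_code e g) (branch_path (2 * k)) n = r) <->
   inf_often (fun m => g k m = r)).
Proof.
  intros Ek Hr. split; intros Hi N.
  - destruct (Hi (S (S (2 * k) + 2 * N))) as [n [Hn E]].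
    destruct (Nat.Even_or_Odd (n - S (2 * k))) as [[m Hm]|[m Hm]].
    + replace n with (S (2 * k) + 2 * m) in E by lia. unfold H_rank_at in E.
      rewrite (proj1 (H_code_branch_run e g k m Ek)) in E. simpl in E. lia.
    + replace n with (S (S (2 * k) + 2 * m)) in E by lia.
      rewrite (proj2 (H_code_branch_run e g k m Ek)) in E.
      exists m. split; [lia|]. destruct (g k m) as [|[|[|]]]; lia.
  - destruct (Hi N) as [m [Hm E]]. exists (S (S (2 * k) + 2 * m)). split; [lia|].
    rewrite (proj2 (H_code_branch_run e g k m Ek)), E. destruct Hr; subst; reflexivity.
Qed.

(** This is what the reduction needs of [H]: finitely many conditions can be imposed, in a number
    not bounded in advance, each asking that 2 recur or that 1 do not. Branch [2 * k] carries row
    [k] of [g]. *)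
Lemma H_code_accepted e g :
  L H (H_code e g) <->
  ~ inf_often (fun k => e k = true) /\
  (forall k, e k = true ->
    inf_often (fun m => g k m = 2) \/ ~ inf_often (fun m => g k m = 1)).
Proof.
  rewrite H_language.
  assert (Hl : inf_often (fun n => H_rank_at (H_code e g) left_path n = 1) <->
               inf_often (fun k => e k = true)).
  { split; intros Hi N.
    - destruct (Hi (2 * N)) as [n [Hn E]]. unfold H_rank_at in E.
      destruct (Nat.Even_or_Odd n) as [[k ->]|[k ->]].
      + now rewrite (proj1 (H_code_left_run e g k)) in E.
      + rewrite Nat.add_1_r, (proj2 (H_code_left_run e g k)) in E.
        exists k. split; [lia|]. destruct (e k); auto; discriminate.
    - destruct (Hi N) as [k [Hk E]]. exists (S (2 * k)). split; [lia|].
      unfold H_rank_at. now rewrite (proj2 (H_code_left_run e g k)), E. }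
  rewrite Hl. split; intros [H0 H1]; split; auto.
  - intros k Ek. specialize (H1 (2 * k)). unfold branch_ok in H1.
    rewrite !H_code_branch_inf_often in H1 by auto. exact H1.
  - intros n. destruct (classic (Nat.Odd n \/ e (Nat.div2 n) = false)) as [Hn|Hn].
    + right. apply not_inf_often. exists (S n). intros k Hk. unfold H_rank_at.
      rewrite settled_rank; [discriminate|].
      apply (H_run_keeps settled _ _ (S n)); auto using settled_step.
      now apply H_code_unused_branch.
    + apply not_or_and in Hn as [Hn En]. destruct (Nat.Even_or_Odd n) as [[k ->]|]; [|tauto].
      rewrite Nat.div2_double in En. apply Bool.not_false_is_true in En.
      unfold branch_ok. rewrite !H_code_branch_inf_often by auto. auto.
Qed.

(** A node of length below [n] reads only entries with indices below [n], since halving does not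
    increase an index. *)
Lemma H_code_agree e e' g g' n :
  (forall k, k < n -> e k = e' k) ->
  (forall k m, k < n -> m < n -> g k m = g' k m) ->
  agree_upto n (H_code e g) (H_code e' g').
Proof.
  intros He Hg y Hy. unfold H_code.
  assert (H : forall i, i + length y < n -> H_code_from e g i y = H_code_from e' g' i y).
  { clear Hy. induction y as [|[] y IH]; intros i Hi; simpl in *.
    - rewrite He; auto. pose proof (Nat.div2_decr i i). lia.
    - rewrite Hg; auto.
      + pose proof (Nat.div2_decr i i). lia.
      + pose proof (Nat.div2_decr (length y) (length y)). lia.
    - apply IH. lia. }
  apply H. lia.
Qed.

(** * Matrices all of whose rows have finitely many ones *)

Definition matrix := nat -> nat -> bool.

Definition rows_finite (x : matrix) : Prop :=
  forall i, ~ inf_often (fun j => x i j = true).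

(** The first [k] rows are fixed entirely, the others only within a square of side [n]. For [k = 0]
    these are the basic open sets of the product topology. *)
Definition matrix_agree (k n : nat) (x y : matrix) : Prop :=
  forall i j, i < k \/ (i < n /\ j < n) -> x i j = y i j.

Definition matrix_open (U : matrix -> Prop) : Prop :=
  forall x, U x -> exists n, forall y, matrix_agree 0 n x y -> U y.

Lemma matrix_agree_weaken k k' n n' x y :
  k <= k' -> n <= n' -> matrix_agree k' n' x y -> matrix_agree k n x y.
Proof. intros Hk Hn H i j Hij. apply H. lia. Qed.

Lemma matrix_agree_trans k n x y z :
  matrix_agree k n x y -> matrix_agree k n y z -> matrix_agree k n x z.
Proof. intros H1 H2 i j Hij. rewrite H1; auto. Qed.

Lemma dependent_choice {T} (I : nat -> T -> Prop) (R : nat -> T -> T -> Prop) x0 :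
  I 0 x0 -> (forall n x, I n x -> exists y, I (S n) y /\ R n x y) ->
  exists f, f 0 = x0 /\ forall n, I n (f n) /\ R n (f n) (f (S n)).
Proof.
  intros H0 HS.
  set (f := fix f n := match n with
    | 0 => x0
    | S n => epsilon (inhabits x0) (fun y => I (S n) y /\ R n (f n) y) end).
  assert (HI : forall n, I n (f n)).
  { induction n as [|n IH]; auto. simpl.
    apply (epsilon_spec (inhabits x0) (fun y => I (S n) y /\ R n (f n) y)). auto. }
  exists f. split; auto. intros n. split; auto. simpl.
  apply (epsilon_spec (inhabits x0) (fun y => I (S n) y /\ R n (f n) y)). auto.
Qed.

Lemma matrix_limit (k n : nat -> nat) (x : nat -> matrix) :
  (forall i, k i <= k (S i)) -> (forall i, n i < n (S i)) -> 0 < n 0 ->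
  (forall i, matrix_agree (k i) (n i) (x i) (x (S i))) ->
  exists z, forall i, matrix_agree (k i) (n i) (x i) z.
Proof.
  intros Hk Hn H0 Hx. assert (Hni : forall i, i < n i).
  { induction i as [|i IH]; auto. specialize (Hn i). lia. }
  assert (Hmono : forall i j, k i <= k (i + j) /\ n i <= n (i + j)).
  { intros i j. induction j as [|j IH]; [rewrite Nat.add_0_r; lia|].
    rewrite Nat.add_succ_r. specialize (Hk (i + j)). specialize (Hn (i + j)). lia. }
  assert (Hchain : forall i j, matrix_agree (k i) (n i) (x i) (x (i + j))).
  { intros i j. induction j as [|j IH]; [rewrite Nat.add_0_r; intros a b _; auto|].
    rewrite Nat.add_succ_r. eapply matrix_agree_trans; [exact IH|].
    eapply matrix_agree_weaken; [| |apply Hx]; apply Hmono. }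
  (* Since [i < n i], the entry at [a], [b] no longer changes from stage [Nat.max a b] on. *)
  exists (fun a b => x (Nat.max a b) a b). intros i a b Hab.
  set (j := Nat.max a b). destruct (le_gt_dec i j) as [Hij|Hij].
  - replace j with (i + (j - i)) by lia. now apply Hchain.
  - symmetry. replace i with (j + (i - j)) by lia. apply Hchain.
    right. pose proof (Hni j). lia.
Qed.

(* The Baire category argument: a G_delta subset of the space of matrices with
   fixed rows below [k] cannot be dense in a basic open set, for otherwise it
   would contain a matrix whose row [k] has infinitely many ones. *)
Lemma rows_finite_nowhere_dense (O : nat -> matrix -> Prop) k x n :
  (forall i, matrix_open (O i)) -> (forall y, (forall i, O i y) -> rows_finite y) ->
  exists x' n', n <= n' /\ matrix_agree k n x x' /\
    forall y, matrix_agree k n' x' y -> ~ forall i, O i y.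
Proof.
  intros HO Hfin. apply NNPP. intros Hdense.
  assert (Hd : forall x' n', n <= n' -> matrix_agree k n x x' ->
            exists y, matrix_agree k n' x' y /\ forall i, O i y).
  { intros x' n' Hn Hx. apply NNPP. intros Hy. apply Hdense. exists x', n'.
    repeat split; auto. intros y Ha Hi. apply Hy. eauto. }
  destruct (dependent_choice
    (fun _ (c : matrix * nat) => n <= snd c /\ k < snd c /\ matrix_agree k n x (fst c))
    (fun i c c' => matrix_agree k (snd c) (fst c) (fst c') /\ snd c < snd c' /\
       fst c' k (snd c) = true /\ forall y, matrix_agree k (snd c') (fst c') y -> O i y)
    (* The square has to contain a part of row [k], so that the ones added to this row are preserved
       at later stages. *)
    (x, Nat.max n (S k))) as [f [_ Hf]].
  - cbn [fst snd]. split; [lia | split; [lia | intros a b _; auto]].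
  - intros i [x1 n1] [Hn1 [Hk1 Hx1]]. cbn [fst snd] in *.
    (* A one is added to row [k] in the first column not yet fixed; density then gives a member of
       the [G_delta] set that keeps it. *)
    set (x2 := fun a b => if ((a =? k) && (b =? n1))%bool then true else x1 a b).
    assert (H12 : matrix_agree k n1 x1 x2).
    { intros a b Hab. unfold x2. destruct (Nat.eqb_spec a k), (Nat.eqb_spec b n1); auto; lia. }
    destruct (Hd x2 (S n1)) as [y [Hy Oy]]; [lia| |].
    { eapply matrix_agree_trans; [exact Hx1|].
      eapply matrix_agree_weaken; [| |exact H12]; lia. }
    destruct (HO i y (Oy i)) as [n2 Hn2].
    assert (H1y : matrix_agree k n1 x1 y).
    { eapply matrix_agree_trans; [exact H12|].
      eapply matrix_agree_weaken; [| |exact Hy]; lia. }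
    exists (y, Nat.max (S n1) n2). cbn [fst snd]. repeat split; auto; try lia.
    + eapply matrix_agree_trans; [exact Hx1|]. eapply matrix_agree_weaken; [| |exact H1y]; lia.
    + rewrite <- Hy by lia. unfold x2. now rewrite !Nat.eqb_refl.
    + intros z Hz. apply Hn2. eapply matrix_agree_weaken; [| |exact Hz]; lia.
  - destruct (matrix_limit (fun _ => k) (fun i => snd (f i)) (fun i => fst (f i))) as [z Hz].
    + auto.
    + intros i. apply Hf.
    + destruct (Hf 0) as [H _]. lia.
    + intros i. apply Hf.
    + apply (Hfin z) with (i := k).
      * intros i. apply (Hf i). apply Hz.
      * assert (Hn : forall i, i <= snd (f i)).
        { induction i as [|i IH]; [lia|]. destruct (Hf i) as [_ H]. lia. }
        intros N. exists (snd (f N)). split; auto.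
        destruct (Hf N) as [_ [_ [Hlt [<- _]]]].
        symmetry. apply Hz. right. destruct (Hf (S N)) as [H _]. lia.
Qed.

(** Diagonalization: stage [k] moves into a neighbourhood disjoint from the [k]-th [G_delta] set and
    then completes row [k] by zeros. The limit has finite rows but lies in none of the sets. *)
Lemma rows_finite_not_Sigma03 (O : nat -> nat -> matrix -> Prop) :
  (forall k i, matrix_open (O k i)) ->
  ~ forall x, rows_finite x <-> exists k, forall i, O k i x.
Proof.
  intros HO HP.
  destruct (dependent_choice
    (fun k (c : matrix * nat) => 0 < snd c /\
       forall i, i < k -> ~ inf_often (fun j => fst c i j = true))
    (fun k c c' => matrix_agree k (snd c) (fst c) (fst c') /\ snd c < snd c' /\
       forall y, matrix_agree (S k) (snd c') (fst c') y -> ~ forall i, O k i y)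
    ((fun _ _ => false), 1)) as [f [_ Hf]].
  - simpl. split; lia.
  - intros k [x n] [Hn Hx]. cbn [fst snd] in *.
    destruct (rows_finite_nowhere_dense (O k) k x n) as [x1 [n1 [Hn1 [Hx1 Hno]]]]; auto.
    { intros y Hy. apply HP. eauto. }
    (* Outside the square row [k] is still free. Making it zero there stays inside the neighbourhood
       just found, and the row is frozen from now on. *)
    set (x2 := fun a b => if ((a =? k) && (n1 <=? b))%bool then false else x1 a b).
    assert (H12 : matrix_agree k n1 x1 x2).
    { intros a b Hab. unfold x2. destruct (Nat.eqb_spec a k), (Nat.leb_spec n1 b); auto; lia. }
    exists (x2, S n1). cbn [fst snd]. repeat split; try lia.
    + intros i Hi. apply not_inf_often.
      destruct (Nat.eq_dec i k) as [->|Hik].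
      * exists n1. intros j Hj. unfold x2. rewrite Nat.eqb_refl.
        rewrite (proj2 (Nat.leb_le _ _) Hj). discriminate.
      * assert (Hx' := Hx i ltac:(lia)). apply not_inf_often in Hx' as [N HN].
        exists N. intros j Hj. rewrite <- H12, <- Hx1 by lia. auto.
    + eapply matrix_agree_trans; [exact Hx1|]. eapply matrix_agree_weaken; [| |exact H12]; lia.
    + intros y Hy. apply Hno. eapply matrix_agree_trans; [exact H12|].
      eapply matrix_agree_weaken; [| |exact Hy]; lia.
  - destruct (matrix_limit (fun k => k) (fun i => snd (f i)) (fun i => fst (f i))) as [z Hz].
    + auto.
    + intros i. apply Hf.
    + apply (Hf 0).
    + intros i. apply Hf.
    + assert (Hfin : rows_finite z).
      { intros i. destruct (Hf (S i)) as [[_ Hi] _]. specialize (Hi i (Nat.lt_succ_diag_r i)).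
        intros Hinf. apply Hi. revert Hinf. apply inf_often_impl.
        intros j <-. apply (Hz (S i)). lia. }
      apply HP in Hfin as [k Hk]. destruct (Hf k) as [_ [_ [_ Hno]]].
      exact (Hno z (Hz (S k)) Hk).
Qed.

Lemma no_Sigma03_reduction {S} (X : tree S -> Prop) (f : matrix -> tree S) :
  (forall x y n, matrix_agree 0 n x y -> agree_upto n (f x) (f y)) ->
  (forall x, rows_finite x <-> X (f x)) -> ~ Sigma03 X.
Proof.
  intros Hf HX [F [HF HFX]].
  (* Countable choice of a [G_delta] presentation of each [F k]; the one chosen at stage [k] has
     index [1 + k]. *)
  destruct (dependent_choice (T := nat -> tree S -> Prop)
    (fun _ _ => True) (fun k _ O => (forall i, is_open (O i)) /\
       forall t, F k t <-> forall i, O i t) (fun _ _ => True)) as [O [_ HO]]; auto.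
  { intros k _ _. destruct (Pi02_elim _ (HF k)) as [O HO]. eauto. }
  apply (rows_finite_not_Sigma03 (fun k i x => O (1 + k) i (f x))).
  - intros k i x Hx. destruct (HO k) as [_ [Ho _]]. destruct (Ho i (f x) Hx) as [n Hn].
    exists n. intros y Hy. auto.
  - intros x. rewrite HX, HFX. split; intros [k Hk]; exists k; now apply (HO k).
Qed.

(** * Trees with a prescribed path *)

Notation comb_step T := ((T * bool) * tree T)%type.

(* The path given by the directions of [s], the tree [snd (s n)] hanging off
   its [n]-th node. *)
Fixpoint comb {T} (s : nat -> comb_step T) (y : list bool) : T :=
  match y with
  | [] => fst (fst (s 0))
  | d :: y => if Bool.eqb d (snd (fst (s 0))) then comb (fun n => s (S n)) y else snd (s 0) y
  end.

Fixpoint comb_state (A : DPTA) (q : st A) (s : nat -> comb_step (alph A)) (n : nat) : st A :=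
  match n with
  | 0 => q
  | S n => comb_state A (target A q (fst (s 0))) (fun k => s (S k)) n
  end.

Definition comb_path {T} (s : nat -> comb_step T) (n : nat) : bool := snd (fst (s n)).

Definition side_accepted (A : DPTA) (q : st A) (z : comb_step (alph A)) : Prop :=
  accepts_from A (target A q (flip A (fst z))) (snd z).

Lemma comb_prefix {T} (s : nat -> comb_step T) n y :
  comb s (prefix (comb_path s) n ++ y) = comb (fun k => s (n + k)) y.
Proof.
  revert s; induction n as [|n IH]; intros s; auto. simpl.
  unfold comb_path at 1. rewrite Bool.eqb_reflx. apply (IH (fun k => s (S k))).
Qed.

Lemma comb_state_ext A q s s' n :
  (forall k, k < n -> s k = s' k) -> comb_state A q s n = comb_state A q s' n.
Proof.
  revert q s s'; induction n as [|n IH]; intros q s s' H; auto. simpl.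
  rewrite (H 0) by lia. apply IH. intros k Hk. apply H. lia.
Qed.

Lemma comb_state_add A q s n m :
  comb_state A q s (n + m) = comb_state A (comb_state A q s n) (fun k => s (n + k)) m.
Proof. revert q s; induction n as [|n IH]; intros q s; auto. simpl. apply IH. Qed.

Lemma comb_state_S A q s n :
  comb_state A q s (S n) = target A (comb_state A q s n) (fst (s n)).
Proof.
  replace (S n) with (n + 1) by lia. rewrite comb_state_add. simpl. now rewrite Nat.add_0_r.
Qed.

Lemma comb_run A q s n :
  run_from A q (comb s) (prefix (comb_path s) n) = comb_state A q s n.
Proof.
  induction n as [|n IH]; auto.
  rewrite run_from_prefix_S, IH, comb_state_S. f_equal.
  rewrite <- (app_nil_r (prefix _ _)), comb_prefix. simpl. rewrite Nat.add_0_r.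
  unfold comb_path. now rewrite <- surjective_pairing.
Qed.

Lemma comb_run_side A q s n :
  run_from A q (comb s) (prefix (comb_path s) n ++ [negb (comb_path s n)]) =
  target A (comb_state A q s n) (flip A (fst (s n))).
Proof.
  rewrite run_from_snoc, comb_run. f_equal.
  rewrite <- (app_nil_r (prefix _ _)), comb_prefix. simpl. now rewrite Nat.add_0_r.
Qed.

Lemma comb_side {T} (s : nat -> comb_step T) n y :
  subtree_at (comb s) (prefix (comb_path s) n ++ [negb (comb_path s n)]) y = snd (s n) y.
Proof.
  unfold subtree_at. rewrite <- app_assoc, comb_prefix. simpl. rewrite Nat.add_0_r.
  unfold comb_path. now destruct (snd (fst (s n))).
Qed.

Lemma accepts_from_ext A q t t' :
  (forall y, t y = t' y) -> accepts_from A q t -> accepts_from A q t'.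
Proof.
  intros E H p. generalize (H p). apply parity_ok_ext. intros n. f_equal.
  apply run_from_ext. auto.
Qed.

(** A path other than the spine has a first node where it leaves the spine, and from there on it
    runs inside a single hanging tree. *)
Lemma comb_accepted A q s :
  accepts_from A q (comb s) <->
  parity_ok (fun n => rank A (comb_state A q s n)) /\
  forall n, side_accepted A (comb_state A q s n) (s n).
Proof.
  split.
  - intros H. split.
    + generalize (H (comb_path s)). apply parity_ok_ext. intros n. now rewrite comb_run.
    + intros n. unfold side_accepted. rewrite <- comb_run_side.
      eapply accepts_from_ext; [apply comb_side|]. now apply accepts_from_subtree.
  - intros [H0 H1] p.
    destruct (classic (exists n, p n <> comb_path s n)) as [Hp|Hp].
    + assert (Hn : exists n, p n <> comb_path s n /\ forall k, k < n -> p k = comb_path s k).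
      { destruct Hp as [n Hn]. induction n as [n IH] using lt_wf_ind.
        destruct (classic (exists k, k < n /\ p k <> comb_path s k)) as [[k [Hk E]]|Hno]; eauto.
        exists n. split; auto. intros k Hk. apply NNPP. eauto. }
      destruct Hn as [n [Hn Hk]].
      assert (E : prefix p (S n) = prefix (comb_path s) n ++ [negb (comb_path s n)]).
      { rewrite prefix_S, (prefix_ext p (comb_path s) n Hk). do 2 f_equal.
        destruct (p n), (comb_path s n); simpl; congruence. }
      apply (parity_ok_tail _ (S n)).
      generalize (H1 n (fun k => p (S n + k))). apply parity_ok_ext. intros m.
      rewrite (prefix_add p (S n) m), E, run_from_app, comb_run_side. f_equal.
      apply run_from_ext. intros y _. symmetry. apply comb_side.
    + revert H0. apply parity_ok_ext. intros n. rewrite <- comb_run. do 2 f_equal.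
      apply prefix_ext. intros k _. apply NNPP. intros Hk. apply Hp. exists k. congruence.
Qed.

Lemma comb_agree {T} (s s' : nat -> comb_step T) n :
  (forall i, i < n -> fst (s i) = fst (s' i) /\ agree_upto n (snd (s i)) (snd (s' i))) ->
  agree_upto n (comb s) (comb s').
Proof.
  intros H y Hy.
  assert (G : forall y m (s s' : nat -> comb_step T), m + length y < n ->
    (forall i, i <= length y -> fst (s i) = fst (s' i) /\ agree_upto n (snd (s i)) (snd (s' i))) ->
    comb s y = comb s' y).
  { clear. induction y as [|d y IH]; intros m s s' Hm H; simpl in *.
    - now rewrite (proj1 (H 0 (le_n _))).
    - destruct (H 0 ltac:(lia)) as [E0 A0]. rewrite E0.
      destruct (Bool.eqb d _).
      + apply (IH (S m)); [lia|]. intros i Hi. apply H. lia.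
      + apply A0. lia. }
  apply (G y 0); [lia|]. intros i Hi. apply H. lia.
Qed.

(** * Infinite concatenations of words *)

(* The word [cur] followed by the concatenation of the words [B 0], [B 1], ...,
   all assumed nonempty; [z] is a junk value. *)
Fixpoint flat {Z} (z : Z) (B : nat -> list Z) (cur : list Z) (n : nat) {struct n} : Z :=
  match cur, n with
  | a :: _, 0 => a
  | _ :: cur, S n => flat z B cur n
  | [], 0 => hd z (B 0)
  | [], S n => flat z (fun k => B (S k)) (tl (B 0)) n
  end.

(** One notion for ranks and for acceptance of side trees, so that passing between blocks and
    positions is proved once. *)
Fixpoint along (A : DPTA) (P : st A -> comb_step (alph A) -> Prop) (q : st A)
    (w : list (comb_step (alph A))) : Prop :=
  match w with [] => True | z :: w => P q z /\ along A P (target A q (fst z)) w end.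

Lemma flat_nil {Z} (z : Z) B n :
  B 0 <> [] -> flat z B [] n = flat z (fun k => B (S k)) (B 0) n.
Proof. destruct n; simpl; destruct (B 0); simpl; congruence. Qed.

Lemma flat_app {Z} (z : Z) B cur n : flat z B cur (length cur + n) = flat z B [] n.
Proof. induction cur as [|a cur IH]; auto. Qed.

Lemma flat_state_app A q z B cur n :
  comb_state A q (flat z B cur) (length cur + n) =
  comb_state A (walk A q (map fst cur)) (flat z B []) n.
Proof. revert q; induction cur as [|a cur IH]; intros q; auto. apply IH. Qed.

(** [o] is the position where block [j] begins. Blocks being nonempty, late blocks begin late. *)
Lemma flat_blocks A p z (B : nat -> list (comb_step (alph A))) q cur j :
  (forall k, B k <> []) -> (forall k, walk A p (map fst (B k)) = p) ->
  walk A q (map fst cur) = p ->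
  exists o, length cur + j <= o /\ comb_state A q (flat z B cur) o = p /\
    forall n, flat z B cur (o + n) = flat z (fun k => B (S j + k)) (B j) n.
Proof.
  revert q cur B. induction j as [|j IH]; intros q cur B Hne Hw Hq.
  - exists (length cur). split; [lia|]. split.
    + rewrite <- (Nat.add_0_r (length cur)), flat_state_app. exact Hq.
    + intros n. rewrite flat_app. now apply flat_nil.
  - destruct (IH p (B 0) (fun k => B (S k))) as [o [Ho [Hs Hf]]]; auto.
    exists (length cur + o). split; [|split].
    + specialize (Hne 0). destruct (B 0); simpl in *; [congruence | lia].
    + rewrite flat_state_app, Hq. etransitivity; [|exact Hs]. apply comb_state_ext.
      intros k _. now apply flat_nil.
    + intros n. rewrite <- Nat.add_assoc, flat_app, flat_nil by auto. apply Hf.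
Qed.

Lemma flat_along A P p z B q cur :
  (forall k, B k <> []) -> (forall k, walk A p (map fst (B k)) = p) ->
  walk A q (map fst cur) = p ->
  along A P q cur -> (forall k, along A P p (B k)) ->
  forall n, P (comb_state A q (flat z B cur) n) (flat z B cur n).
Proof.
  intros Hne Hw Hq Hc HB n. revert q cur B Hne Hw Hq Hc HB.
  induction n as [|n IH]; intros q [|a cur] B Hne Hw Hq Hc HB.
  - simpl in *. subst q. specialize (HB 0). specialize (Hne 0).
    destruct (B 0) as [|a cur]; [congruence | apply HB].
  - apply Hc.
  - simpl in Hq. subst q. cbn [comb_state flat].
    generalize (HB 0), (Hne 0), (Hw 0). destruct (B 0) as [|a cur]; [congruence|].
    intros [_ HB0] _ Hw0. apply IH; auto.
  - simpl in *. apply IH; tauto.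
Qed.

Lemma along_flat A P z B q cur :
  (forall n, P (comb_state A q (flat z B cur) n) (flat z B cur n)) -> along A P q cur.
Proof.
  revert q. induction cur as [|a cur IH]; intros q H; simpl; auto. split.
  - apply (H 0).
  - apply IH. intros n. apply (H (S n)).
Qed.

(** Block [j] begins at a position not before [j], so what holds from position [N] on holds along
    all of it. *)
Lemma flat_block_along A P p z B q cur N j :
  (forall k, B k <> []) -> (forall k, walk A p (map fst (B k)) = p) ->
  walk A q (map fst cur) = p -> N <= j ->
  (forall n, N <= n -> P (comb_state A q (flat z B cur) n) (flat z B cur n)) ->
  along A P p (B j).
Proof.
  intros Hne Hw Hq HN H.
  destruct (flat_blocks A p z B q cur j Hne Hw Hq) as [o [Ho [Hs Hf]]].
  apply (along_flat A P z (fun k => B (S j + k))). intros n.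
  rewrite <- Hf, <- (comb_state_ext A p (fun n => flat z B cur (o + n))) by auto.
  specialize (H (o + n) ltac:(lia)). now rewrite comb_state_add, Hs in H.
Qed.

Lemma along_ranks A (P : nat -> Prop) q w :
  along A (fun q z => P (rank A (target A q (fst z)))) q w <->
  forall r, In r (ranks A q (map fst w)) -> P r.
Proof.
  revert q; induction w as [|a w IH]; intros q; simpl; [tauto|].
  rewrite IH. split; [intros [H1 H2] r [<-|Hr] | intros H]; auto.
Qed.

Lemma flat_max_inf A p z B q cur m :
  (forall k, B k <> []) -> (forall k, walk A p (map fst (B k)) = p) ->
  walk A q (map fst cur) = p ->
  inf_often (fun j => In m (ranks A p (map fst (B j)))) ->
  (exists J, forall j, J <= j -> forall r, In r (ranks A p (map fst (B j))) -> r <= m) ->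
  max_inf (fun n => rank A (comb_state A q (flat z B cur) n)) m.
Proof.
  intros Hne Hw Hq Hi [J HJ]. split.
  - intros N. destruct (Hi N) as [j [Hj Hm]]. apply NNPP. intros Hno.
    assert (H : along A (fun q z => rank A (target A q (fst z)) <> m) p (B j)).
    { apply (flat_block_along A _ p z B q cur N); auto. intros n Hn E. apply Hno.
      exists (S n). rewrite comb_state_S. split; auto. }
    rewrite (along_ranks A (fun r => r <> m)) in H. exact (H m Hm eq_refl).
  - destruct (flat_blocks A p z B q cur J Hne Hw Hq) as [o [_ [Hs Hf]]].
    (* [ranks] omits the state in which a block begins, hence the bound starts one position after
       [o]. *)
    exists (S o). intros n Hn.
    replace n with (o + S (n - S o)) by lia. rewrite comb_state_add, Hs.
    rewrite (comb_state_ext A p _ (flat z (fun k => B (S J + k)) (B J))) by auto.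
    rewrite comb_state_S.
    apply (flat_along A (fun q z => rank A (target A q (fst z)) <= m) p); auto.
    + apply (along_ranks A (fun r => r <= m)). apply HJ. lia.
    + intros k. apply (along_ranks A (fun r => r <= m)). apply HJ. lia.
Qed.

(** Reading a position opens at most one new block, so position [n] depends only on blocks up to
    [n]. Continuity of the constructions below rests on this. *)
Lemma flat_related {Z} (R : Z -> Z -> Prop) z B B' cur cur' n :
  R z z -> Forall2 R cur cur' -> (forall k, k <= n -> Forall2 R (B k) (B' k)) ->
  R (flat z B cur n) (flat z B' cur' n).
Proof.
  intros Hz. revert B B' cur cur'. induction n as [|n IH]; intros B B' cur cur' Hc HB.
  - destruct Hc; auto. simpl. destruct (HB 0 (le_n _)); auto.
  - destruct Hc; simpl.
    + apply IH; [|intros k Hk; apply HB; lia].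
      destruct (HB 0 (Nat.le_0_l _)); simpl; auto.
    + apply IH; auto.
Qed.

(** * A replicated flower makes the language harder than [Sigma03] *)

Definition accepted_tree (A : DPTA) (q : st A) (a : alph A) : tree (alph A) :=
  epsilon (inhabits (fun _ => a)) (accepts_from A q).

Fixpoint pad (A : DPTA) (q : st A) (w : list (alph A * bool)) : list (comb_step (alph A)) :=
  match w with
  | [] => []
  | s :: w => (s, accepted_tree A (target A q (flip A s)) (fst s)) :: pad A (target A q s) w
  end.

Lemma pad_word A q w : map fst (pad A q w) = w.
Proof. revert q; induction w; simpl; intros; congruence. Qed.

Lemma pad_side_accepted A q w : live A q w -> along A (side_accepted A) q (pad A q w).
Proof.
  revert q; induction w as [|s w IH]; simpl; auto. intros q [Hp Hl]. split; auto.
  unfold side_accepted. cbn [fst snd]. unfold accepted_tree. apply epsilon_spec. apply Hp.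
Qed.

Lemma along_app A P q w w' :
  along A P q (w ++ w') <-> along A P q w /\ along A P (walk A q (map fst w)) w'.
Proof. revert q; induction w; simpl; intros; [tauto|]. rewrite IHw. tauto. Qed.

Lemma loop_nonempty A q m w : loop A q m w -> w <> [].
Proof. intros [_ [_ [H _]]] ->. destruct H. Qed.

Definition junk_step {T} (a : T) : comb_step T := ((a, false), fun _ => a).

Lemma pad_nonempty A q w : w <> [] -> pad A q w <> [].
Proof. destruct w; simpl; congruence. Qed.

Definition row (A : DPTA) (q p : st A) (a : alph A) (v w0 w1 : list (alph A * bool))
    (f : nat -> bool) : tree (alph A) :=
  comb (flat (junk_step a) (fun j => pad A p (if f j then w1 else w0)) (pad A q v)).

(** Turn [j] takes the odd loop if [f j] holds and the even one otherwise. As [m0 < m1], the limit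
    superior of the ranks is [m1] if the odd loop recurs and [m0] if not; the padding is always
    accepted. *)
Lemma row_accepted A q a v w0 w1 m0 m1 f :
  live A q v -> loop A (walk A q v) m0 w0 -> loop A (walk A q v) m1 w1 ->
  Nat.Even m0 -> Nat.Odd m1 -> m0 < m1 ->
  (accepts_from A q (row A q (walk A q v) a v w0 w1 f) <-> ~ inf_often (fun j => f j = true)).
Proof.
  intros Hv Hw0 Hw1 He Ho Hlt. set (p := walk A q v) in *.
  set (B := fun j => pad A p (if f j then w1 else w0)).
  assert (Hne : forall k, B k <> []).
  { intros k. apply pad_nonempty. destruct (f k); eapply loop_nonempty; eauto. }
  assert (Hw : forall k, walk A p (map fst (B k)) = p).
  { intros k. unfold B. rewrite pad_word. destruct (f k); [apply Hw1 | apply Hw0]. }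
  assert (Hq : walk A q (map fst (pad A q v)) = p) by now rewrite pad_word.
  unfold row. fold B. rewrite comb_accepted.
  destruct (classic (inf_often (fun j => f j = true))) as [Hf|Hf].
  - split; [|tauto]. intros [Hok _]. exfalso.
    rewrite (parity_ok_max_inf _ m1) in Hok.
    + eapply Nat.Even_Odd_False; eauto.
    + apply (flat_max_inf A p); auto.
      * revert Hf. apply inf_often_impl. intros j Hj. unfold B. rewrite pad_word, Hj. apply Hw1.
      * exists 0. intros j _ r Hr. unfold B in Hr. rewrite pad_word in Hr.
        destruct (f j); [now apply Hw1|]. apply Hw0 in Hr. lia.
  - split; auto. intros _. apply not_inf_often in Hf as [N HN].
    assert (HB : forall j, N <= j -> B j = pad A p w0).
    { intros j Hj. unfold B. specialize (HN j Hj). destruct (f j); congruence. }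
    split.
    + apply (parity_ok_max_inf _ m0); auto. apply (flat_max_inf A p); auto.
      * intros K. exists (Nat.max N K). split; [lia|]. rewrite HB by lia. rewrite pad_word. apply Hw0.
      * exists N. intros j Hj r Hr. rewrite HB, pad_word in Hr by auto. now apply Hw0.
    + apply (flat_along A (side_accepted A) p); auto using pad_side_accepted.
      intros k. apply pad_side_accepted. destruct (f k); [apply Hw1 | apply Hw0].
Qed.

Definition step_agree {T} (n : nat) (z z' : comb_step T) : Prop :=
  fst z = fst z' /\ agree_upto n (snd z) (snd z').

Lemma steps_agree_refl {T} n (w : list (comb_step T)) : Forall2 (step_agree n) w w.
Proof. induction w; constructor; auto. split; auto. intros y _; auto. Qed.

Lemma row_agree A q p a v w0 w1 f f' n :
  (forall j, j < n -> f j = f' j) ->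
  agree_upto n (row A q p a v w0 w1 f) (row A q p a v w0 w1 f').
Proof.
  intros H. apply comb_agree. intros i Hi. apply (flat_related (step_agree n)).
  - split; auto. intros y _; auto.
  - apply steps_agree_refl.
  - intros k Hk. rewrite H by lia. apply steps_agree_refl.
Qed.

(** The even loop is repeated forever, and in turn [k] the tree coding row [k] of the matrix hangs
    off the step [s]. The spine has even limit superior [m], so acceptance means that every row has
    finitely many ones. *)
Lemma replicates_flower_not_Sigma03 A : replicates_flower A -> ~ Sigma03 (L A).
Proof.
  intros [u [m [w1 [s [w2 [Hu [He [Hloop [v [Hv [m0 [m1 [v0 [v1 [Hm0 [Hm1 [Hlt [Hv0 Hv1]]]]]]]]]]]]]]]]]].
  set (q := walk A (init A) u) in *. set (q1 := walk A q w1) in *.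
  set (r := target A q1 (flip A s)) in *.
  set (R := fun f => row A r (walk A r v) (fst s) v v0 v1 f).
  set (B := fun (x : matrix) k => pad A q w1 ++ (s, R (x k)) :: pad A (target A q1 s) w2).
  set (S := fun x => flat (junk_step (fst s)) (B x) (pad A (init A) u)).
  assert (HR : forall f, accepts_from A r (R f) <-> ~ inf_often (fun j => f j = true)).
  { intros f. apply (row_accepted A r (fst s) v v0 v1 m0 m1); auto. }
  assert (HB : forall x k, map fst (B x k) = w1 ++ s :: w2).
  { intros x k. unfold B. rewrite map_app. simpl. now rewrite !pad_word. }
  assert (Hne : forall x k, B x k <> []).
  { intros x k E. specialize (HB x k). rewrite E in HB. destruct w1; discriminate. }
  assert (Hw : forall x k, walk A q (map fst (B x k)) = q).
  { intros x k. rewrite HB. apply Hloop. }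
  assert (Hq : walk A (init A) (map fst (pad A (init A) u)) = q) by now rewrite pad_word.
  assert (Hl : live A q w1 /\ live A (target A q1 s) w2).
  { destruct Hloop as [Hl _]. apply live_app in Hl as [Hl1 Hl2]. split; auto. apply Hl2. }
  assert (Hblock : forall x k, along A (side_accepted A) q (B x k) <-> accepts_from A r (R (x k))).
  { intros x k. unfold B. rewrite along_app, pad_word. fold q1. simpl.
    split; [tauto|]. intros Hr. repeat split; auto; now apply pad_side_accepted. }
  apply (no_Sigma03_reduction (L A) (fun x => comb (S x))).
  - intros x y n Hxy. apply comb_agree. intros i Hi. unfold S.
    apply (flat_related (step_agree n)).
    + split; auto. intros z _; auto.
    + apply steps_agree_refl.
    + intros k Hk. apply Forall2_app; [apply steps_agree_refl|].
      constructor; [|apply steps_agree_refl]. split; auto. apply row_agree.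
      intros j Hj. apply Hxy. lia.
  - intros x. change (L A (comb (S x))) with (accepts_from A (init A) (comb (S x))).
    rewrite comb_accepted. split.
    + intros Hx. split.
      * apply (parity_ok_max_inf _ m); auto. apply (flat_max_inf A q); auto.
        -- intros N. exists N. split; auto. rewrite HB. apply Hloop.
        -- exists 0. intros j _. rewrite HB. apply Hloop.
      * apply (flat_along A (side_accepted A) q); auto using pad_side_accepted.
        intros k. apply Hblock, HR, Hx.
    + intros [_ Hside] k. apply HR, Hblock.
      apply (flat_block_along A (side_accepted A) q (junk_step (fst s)) (B x) (init A)
               (pad A (init A) u) 0); auto. lia.
Qed.

(** * Automata without a replicated flower reduce to [H] *)

(** The Buechi states: those of maximal rank on an even loop through them. Flowering states are
    included, so that paths staying among them satisfy the Buechi condition trivially. *)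
Definition good (A : DPTA) (q : st A) : Prop :=
  flowering A q \/ (Nat.Even (rank A q) /\ exists w, loop A q (rank A q) w).

Definition branching (A : DPTA) (r : list bool -> st A) (x : list bool) : Prop :=
  forall d, flowering A (r (x ++ [d])).

(** [follow] turns left whenever the left child is flowering. A path inside the flowering subtree
    can therefore deviate from it only into the right child of a branching node, where a new
    followed path starts. *)
Definition start (A : DPTA) (r : list bool -> st A) (x : list bool) : Prop :=
  x = [] \/ exists y, x = y ++ [true] /\ branching A r y.

Definition follow_dir (A : DPTA) (r : list bool -> st A) (x : list bool) : bool :=
  negb (dec (flowering A (r (x ++ [false])))).

Fixpoint follow (A : DPTA) (r : list bool -> st A) (x : list bool) (n : nat) : list bool :=
  match n with
  | 0 => x
  | S n => follow A r x n ++ [follow_dir A r (follow A r x n)]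
  end.

Fixpoint good_count (A : DPTA) (r : list bool -> st A) (p : nat -> bool) (n : nat) : nat :=
  match n with
  | 0 => 0
  | S n => (if dec (good A (r (prefix p n))) then 1 else 0) + good_count A r p n
  end.

Definition all_good_count A r (n c : nat) : Prop := forall p, c <= good_count A r p n.

(** The least number of good visits over all paths grows between levels [n] and [S n]. This depends
    on finitely many nodes, and its recurrence replaces a Buechi condition on every path. *)
Definition progress (A : DPTA) (r : list bool -> st A) (n : nat) : Prop :=
  (forall x, length x <= n -> productive A (r x)) /\
  exists c, all_good_count A r (S n) c /\ ~ all_good_count A r n c.

Definition spawned (A : DPTA) (M : nat) (r : list bool -> st A) (k : nat) : bool :=
  dec (start A r (fst (decode k)) /\ snd (decode k) <= M).

(* The index [(x, 0)] carries the Buechi condition on all paths, the index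
   [(x, m)] with [m] odd the Streett pair of [m] on the path followed from [x]. *)
Definition component (A : DPTA) (r : list bool -> st A) (k n : nat) : nat :=
  let (x, m) := decode k in
  if m =? 0 then if dec (progress A r n) then 2 else 1
  else let q := r (follow A r x n) in
    if dec (flowering A q /\ Nat.Odd m /\ rank A q = m) then 1
    else if dec (flowering A q /\ Nat.Odd m /\ Nat.Even (rank A q) /\ m < rank A q) then 2
    else 0.

Definition reduction (A : DPTA) (M : nat) (t : tree (alph A)) : tree HAlph :=
  H_code (spawned A M (run A t)) (component A (run A t)).

(** * Continuity of the reduction *)

Definition same_upto {S} (n : nat) (r r' : list bool -> S) : Prop :=
  forall x, length x <= n -> r x = r' x.

Lemma follow_length A r x n : length (follow A r x n) = length x + n.
Proof.
  induction n as [|n IH]; simpl; [lia|]. rewrite length_app, IH. simpl. lia.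
Qed.

Lemma start_same A n r r' x :
  same_upto n r r' -> length x <= n -> start A r x -> start A r' x.
Proof.
  intros H Hx [->|[y [-> Hy]]]; [now left|]. right. exists y. split; auto.
  rewrite length_app in Hx. simpl in Hx.
  intros d. rewrite <- H; [apply Hy|]. rewrite length_app. simpl. lia.
Qed.

Lemma follow_same A n r r' x k :
  same_upto n r r' -> length x + k <= n -> follow A r x k = follow A r' x k.
Proof.
  intros H. induction k as [|k IH]; intros Hk; auto. simpl.
  rewrite IH by lia. do 2 f_equal. unfold follow_dir. f_equal. apply dec_ext.
  rewrite H; [tauto|]. rewrite length_app, follow_length. simpl. lia.
Qed.

Lemma good_count_same A n r r' p k :
  same_upto n r r' -> k <= S n -> good_count A r p k = good_count A r' p k.
Proof.
  intros H. induction k as [|k IH]; intros Hk; auto. simpl.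
  rewrite IH, H by (rewrite ?prefix_length; lia). reflexivity.
Qed.

Lemma all_good_count_same A n r r' k c :
  same_upto n r r' -> k <= S n -> all_good_count A r k c -> all_good_count A r' k c.
Proof.
  intros H Hk Hc p. rewrite <- (good_count_same A n r r'); auto.
Qed.

Lemma same_upto_sym {S} n (r r' : list bool -> S) : same_upto n r r' -> same_upto n r' r.
Proof. intros H x Hx. symmetry. auto. Qed.

Lemma progress_same A n r r' k :
  same_upto n r r' -> k <= n -> progress A r k -> progress A r' k.
Proof.
  intros H Hk [Hp [c [H1 H2]]]. split.
  - intros x Hx. rewrite <- H by lia. auto.
  - exists c. split.
    + eapply all_good_count_same; eauto. lia.
    + intros Hc. apply H2. apply same_upto_sym in H.
      eapply all_good_count_same; eauto.
Qed.

Lemma reduction_continuous A M : continuous (reduction A M).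
Proof.
  (* [D] bounds the starting nodes with index up to [n]; following a path from one of them for fewer
     than [n] steps stays within depth [D + n]. *)
  intros t n. destruct (bounded_on_initial (fun k => length (fst (decode k))) n) as [D HD].
  exists (D + n). intros s Hs.
  assert (H : same_upto (D + n) (run A t) (run A s)) by (intros x Hx; eapply run_agree; eauto).
  assert (H' := same_upto_sym _ _ _ H).
  apply H_code_agree.
  - intros k Hk. specialize (HD k ltac:(lia)). apply dec_ext.
    split; intros [H1 H2]; split; auto; eapply start_same; eauto; lia.
  - intros k m Hk Hm. specialize (HD k ltac:(lia)). unfold component.
    destruct (decode k) as [x j]. cbn [fst] in HD. destruct (j =? 0).
    + replace (dec (progress A (run A t) m)) with (dec (progress A (run A s) m)); auto.
      apply dec_ext. split; apply (progress_same A (D + n)); auto; lia.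
    + rewrite (follow_same A (D + n) (run A t) (run A s)) by (auto; lia).
      rewrite H by (rewrite follow_length; lia). reflexivity.
Qed.

(** * The Buechi condition on all paths as a single condition *)

Lemma good_count_le A r p n : good_count A r p n <= n.
Proof. induction n; simpl; auto. destruct (dec _); lia. Qed.

Lemma good_count_mono A r p n n' : n <= n' -> good_count A r p n <= good_count A r p n'.
Proof. induction 1; simpl; lia. Qed.

Lemma good_count_prefix A r p p' n :
  prefix p n = prefix p' n -> good_count A r p n = good_count A r p' n.
Proof.
  induction n as [|n IH]; intros E; auto. simpl.
  rewrite !prefix_S in E. apply app_inj_tail in E as [E _].
  rewrite IH, E; auto.
Qed.

Lemma inf_often_good_iff A r p :
  inf_often (fun n => good A (r (prefix p n))) <-> forall c, exists n, c <= good_count A r p n.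
Proof.
  split.
  - intros Hi c. induction c as [|c [n IH]]; [exists 0; lia|].
    destruct (Hi n) as [k [Hk Hg]]. exists (S k). simpl.
    rewrite (proj2 (dec_true _) Hg). pose proof (good_count_mono A r p n k Hk). lia.
  - intros Hc. apply NNPP. intros Hn. apply not_inf_often in Hn as [N HN].
    assert (H : forall n, good_count A r p (N + n) <= N).
    { induction n as [|n IH]; [rewrite Nat.add_0_r; apply good_count_le|].
      rewrite Nat.add_succ_r. simpl.
      rewrite (proj2 (dec_false _) (HN (N + n) ltac:(lia))). lia. }
    destruct (Hc (S N)) as [n Hn]. specialize (H n).
    pose proof (good_count_mono A r p n (N + n) ltac:(lia)). lia.
Qed.

Lemma all_good_count_mono A r n n' c :
  n <= n' -> all_good_count A r n c -> all_good_count A r n' c.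
Proof. intros Hn H p. pose proof (good_count_mono A r p n n' Hn). specialize (H p). lia. Qed.

(** If [c] visits were never reached uniformly, Koenig's lemma would give a path each of whose
    prefixes extends to paths with fewer than [c] visits up to any level. Visits depend only on the
    prefix, so the path itself would have fewer than [c]. *)
Lemma all_good_count_unbounded A r :
  (forall p, inf_often (fun n => good A (r (prefix p n)))) ->
  forall c, exists n, all_good_count A r n c.
Proof.
  intros Hi c. apply NNPP. intros Hn.
  assert (Hn' : forall n, exists p, good_count A r p n < c).
  { intros n. apply NNPP. intros Hp. apply Hn. exists n. intros p.
    apply Nat.nlt_ge. eauto. }
  destruct (koenig (fun x => forall n, exists p, prefix p (length x) = x /\ good_count A r p n < c))
    as [p Hp].
  - intros n. destruct (Hn' n) as [p Hp]. exists p. auto.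
  - intros x Hx. apply NNPP. intros Hd.
    assert (Hd' : forall d, exists n, forall p, prefix p (S (length x)) = x ++ [d] ->
                 c <= good_count A r p n).
    { intros d. apply NNPP. intros Hdn. apply Hd. exists d. intros n. apply NNPP.
      intros Hpn. apply Hdn. exists n. intros p Ep. apply Nat.nlt_ge. intros Hlt.
      apply Hpn. exists p. rewrite length_app, Nat.add_1_r. auto. }
    destruct (Hd' true) as [n1 Hn1], (Hd' false) as [n2 Hn2].
    destruct (Hx (Nat.max n1 n2)) as [p [Ep Hlt]].
    assert (E : prefix p (S (length x)) = x ++ [p (length x)]) by now rewrite prefix_S, Ep.
    destruct (p (length x)).
    + specialize (Hn1 p E). pose proof (good_count_mono A r p n1 (Nat.max n1 n2) ltac:(lia)). lia.
    + specialize (Hn2 p E). pose proof (good_count_mono A r p n2 (Nat.max n1 n2) ltac:(lia)). lia.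
  - destruct (proj1 (inf_often_good_iff A r p) (Hi p) c) as [n Hc].
    destruct (Hp n n) as [p' [E Hlt]]. rewrite prefix_length in E.
    apply (good_count_prefix A r) in E. lia.
Qed.

Lemma inf_often_progress_iff A r :
  inf_often (progress A r) <->
  (forall x, productive A (r x)) /\ forall p, inf_often (fun n => good A (r (prefix p n))).
Proof.
  split.
  - intros Hi. split.
    + intros x. destruct (Hi (length x)) as [n [Hn [Hp _]]]. auto.
    + intros p. apply inf_often_good_iff. intros c.
      enough (H : exists n, all_good_count A r n c) by (destruct H as [n H]; eauto).
      induction c as [|c [n IH]]; [exists 0; intros p'; lia|].
      destruct (Hi n) as [n' [Hn [_ [c' [H1 H2]]]]]. exists (S n').
      (* At level [n'] all paths already have [c] visits but not all have [c'], so [c'] exceeds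
         [c]. *)
      intros p'. specialize (H1 p'). destruct (le_gt_dec c' c) as [Hc|Hc]; [|lia].
      exfalso. apply H2. intros p''. specialize (IH p'').
      pose proof (good_count_mono A r p'' n n' Hn). lia.
  - intros [Hp Hi] N.
    destruct (all_good_count_unbounded A r Hi (S N)) as [n0 Hn0].
    (* [N] levels allow at most [N] visits, so the minimum reaches [S N] only after level [N]. *)
    assert (HN : ~ all_good_count A r N (S N)).
    { intros Hc. specialize (Hc (fun _ => true)).
      pose proof (good_count_le A r (fun _ => true) N). lia. }
    assert (H : forall j, all_good_count A r (N + j) (S N) ->
      exists n, N <= n /\ all_good_count A r (S n) (S N) /\ ~ all_good_count A r n (S N)).
    { induction j as [|j IH]; intros Hj; [rewrite Nat.add_0_r in Hj; contradiction|].
      destruct (classic (all_good_count A r (N + j) (S N))); auto.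
      rewrite Nat.add_succ_r in Hj. exists (N + j). split; [lia|auto]. }
    destruct (H n0) as [n [Hn [H1 H2]]].
    + eapply all_good_count_mono; [|eauto]. lia.
    + exists n. split; auto. split; eauto.
Qed.

(** * Accepted runs visit good states and branch finitely often *)

Lemma good_on_accepted_path A t p :
  (forall x, productive A (run A t x)) ->
  parity_ok (fun n => rank A (run A t (prefix p n))) ->
  inf_often (fun n => good A (run A t (prefix p n))).
Proof.
  intros Hp Hok. destruct (rank_bounded A) as [M HM].
  destruct (max_inf_exists (fun n => rank A (run A t (prefix p n))) M) as [m Hm]; auto.
  rewrite (parity_ok_max_inf _ m Hm) in Hok. destruct Hm as [Hi [N HN]].
  destruct (inf_often_state A (fun n => run A t (prefix p n)) _ Hi) as [q Hq].
  intros K. destruct (Hq (Nat.max N K)) as [i [Hi1 [Hi2 Hi3]]].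
  destruct (Hq (S i)) as [j [Hj1 [Hj2 Hj3]]].
  exists i. split; [lia|]. right. rewrite Hi2. split; auto.
  eexists. apply (segment_loop A t p i j j m); auto; [congruence|].
  intros n Hn. apply HN. lia.
Qed.

Lemma flowering_ancestor A t x y :
  (forall x, productive A (run A t x)) ->
  flowering A (run A t (x ++ y)) -> flowering A (run A t x).
Proof.
  intros Hp. induction y as [|d y IH] using rev_ind; [now rewrite app_nil_r|].
  intros Hf. apply IH. unfold run in *. rewrite app_assoc, run_from_snoc in Hf.
  eapply flowering_parent; eauto. intros d'. rewrite <- run_from_snoc. apply Hp.
Qed.

Lemma flowering_prefix A t p i j :
  (forall x, productive A (run A t x)) -> i <= j ->
  flowering A (run A t (prefix p j)) -> flowering A (run A t (prefix p i)).
Proof.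
  intros Hp Hij. replace j with (i + (j - i)) by lia. rewrite prefix_add.
  now apply flowering_ancestor.
Qed.

(** Between two visits to a recurring state of the highest recurrent rank, which is even, lies a
    branching node. The path closes an even loop there, and the child off the loop is flowering. *)
Lemma accepted_path_branching A t p :
  ~ replicates_flower A -> (forall x, productive A (run A t x)) ->
  parity_ok (fun n => rank A (run A t (prefix p n))) ->
  ~ inf_often (fun n => branching A (run A t) (prefix p n)).
Proof.
  intros Hno Hp Hok Hb. destruct (rank_bounded A) as [M HM].
  destruct (max_inf_exists (fun n => rank A (run A t (prefix p n))) M) as [m Hm]; auto.
  rewrite (parity_ok_max_inf _ m Hm) in Hok. destruct Hm as [Hi [N HN]].
  destruct (inf_often_state A (fun n => run A t (prefix p n)) _ Hi) as [q Hq].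
  destruct (Hq N) as [i [Hi1 [Hi2 Hi3]]].
  destruct (Hb i) as [k [Hk1 Hk2]].
  destruct (Hq (S k)) as [j [Hj1 [Hj2 Hj3]]].
  assert (Ew : walk A (init A) (segment t p 0 i) = run A t (prefix p i))
    by exact (walk_segment A t p 0 i).
  apply Hno.
  exists (segment t p 0 i), m, (segment t p i (k - i)), (t (prefix p k), p k),
    (segment t p (S k) (j - S k)).
  rewrite Ew. split; [|split; [|split]]; auto.
  - apply (live_segment A t p 0 i Hp).
  - replace (segment t p i (k - i) ++ _) with (segment t p i (j - i)).
    + apply (segment_loop A t p i j j m); auto; [lia | congruence |].
      intros n Hn. apply HN. lia.
    + replace (j - i) with ((k - i) + S (j - S k)) by lia.
      rewrite segment_add. replace (i + (k - i)) with k by lia. reflexivity.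
  - rewrite walk_segment. replace (i + (k - i)) with k by lia.
    unfold flip, run. simpl. rewrite <- run_from_snoc. apply Hk2.
Qed.

Lemma accepted_finitely_branching A t :
  ~ replicates_flower A -> L A t ->
  exists N, forall x, branching A (run A t) x -> length x <= N.
Proof.
  intros Hno Ht. assert (Hp : forall x, productive A (run A t x)).
  { intros x. now apply productive_subtree. }
  apply NNPP. intros Hn.
  destruct (koenig (fun x => forall N, exists y, N <= length y /\ branching A (run A t) (x ++ y)))
    as [p HP].
  - intros N. apply NNPP. intros Hy. apply Hn. exists N. intros x Hx.
    destruct (le_gt_dec (length x) N); auto. exfalso. apply Hy. exists x. split; auto. lia.
  - intros x Hx. apply NNPP. intros Hd.
    assert (Hd' : forall d, exists N, forall y, branching A (run A t) ((x ++ [d]) ++ y) -> length y < N).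
    { intros d. apply NNPP. intros Hdn. apply Hd. exists d. intros N. apply NNPP.
      intros Hy. apply Hdn. exists N. intros y Hby. apply Nat.nle_gt. eauto. }
    destruct (Hd' true) as [N1 H1], (Hd' false) as [N2 H2].
    destruct (Hx (S (N1 + N2))) as [[|d y] [Hy Hb]]; simpl in Hy; [lia|].
    replace (x ++ d :: y) with ((x ++ [d]) ++ y) in Hb by (rewrite <- app_assoc; reflexivity).
    destruct d; [apply H1 in Hb | apply H2 in Hb]; lia.
  - apply (accepted_path_branching A t p Hno Hp (Ht p)).
    assert (HW : forall n, flowering A (run A t (prefix p n))).
    { intros n. destruct (HP n 0) as [y [_ Hy]]. specialize (Hy true).
      rewrite <- app_assoc in Hy. now apply flowering_ancestor in Hy. }
    intros N. apply NNPP. intros Hnb.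
    (* If [p] has no branching node from [N] on, the flowering nodes below [prefix p N] all lie on
       [p], and hence so does any branching node there. *)
    assert (Hon : forall y, flowering A (run A t (prefix p N ++ y)) ->
              prefix p N ++ y = prefix p (N + length y)).
    { induction y as [|d y IH] using rev_ind; intros Hy.
      - now rewrite app_nil_r, Nat.add_0_r.
      - rewrite length_app. simpl. rewrite app_assoc in Hy |- *.
        rewrite IH in Hy |- * by (eapply flowering_ancestor; eauto).
        replace (N + (length y + 1)) with (S (N + length y)) by lia.
        rewrite prefix_S. do 2 f_equal.
        destruct (Bool.bool_dec d (p (N + length y))) as [|Hne]; auto.
        exfalso. apply Hnb. exists (N + length y). split; [lia|].
        intros d'. specialize (HW (S (N + length y))). rewrite prefix_S in HW.
        destruct d, d', (p (N + length y)); congruence. }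
    destruct (HP N 0) as [y [_ Hy]]. apply Hnb. exists (N + length y). split; [lia|].
    rewrite <- Hon; auto. specialize (Hy true). now apply flowering_ancestor in Hy.
Qed.

(** * The conditions imposed by the components *)

Lemma follow_path A r x : exists p, forall n, prefix p (length x + n) = follow A r x n.
Proof. apply (path_through (follow A r x) (fun n => follow_dir A r (follow A r x n))). auto. Qed.

Lemma component_Buechi A r k :
  snd (decode k) = 0 ->
  (inf_often (fun n => component A r k n = 2) \/ ~ inf_often (fun n => component A r k n = 1) <->
   inf_often (progress A r)).
Proof.
  intros Ek. unfold component. destruct (decode k) as [x m]. simpl in Ek. subst m. simpl.
  split.
  - intros [Hi|Hi].
    + revert Hi. apply inf_often_impl. intros n. destruct (dec (progress A r n)) eqn:E; [|discriminate].
      intros _. now apply dec_true.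
    + apply not_inf_often in Hi as [N HN]. intros K. exists (Nat.max N K). split; [lia|].
      specialize (HN (Nat.max N K) ltac:(lia)).
      destruct (dec (progress A r (Nat.max N K))) eqn:E; [now apply dec_true | congruence].
  - intros Hi. left. revert Hi. apply inf_often_impl. intros n Hn.
    now rewrite (proj2 (dec_true _) Hn).
Qed.

Lemma component_1 A r k n :
  snd (decode k) <> 0 ->
  (component A r k n = 1 <->
   let q := r (follow A r (fst (decode k)) n) in
   flowering A q /\ Nat.Odd (snd (decode k)) /\ rank A q = snd (decode k)).
Proof.
  unfold component. destruct (decode k) as [x m]. cbn [fst snd]. intros Hm.
  apply Nat.eqb_neq in Hm. rewrite Hm. cbv zeta.
  destruct (dec (flowering A _ /\ Nat.Odd m /\ rank A _ = m)) eqn:E.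
  - rewrite dec_true in E. tauto.
  - rewrite dec_false in E. split; [|tauto]. destruct (dec _); discriminate.
Qed.

Lemma component_2 A r k n :
  snd (decode k) <> 0 ->
  (component A r k n = 2 <->
   let q := r (follow A r (fst (decode k)) n) in
   flowering A q /\ Nat.Odd (snd (decode k)) /\ Nat.Even (rank A q) /\ snd (decode k) < rank A q).
Proof.
  unfold component. destruct (decode k) as [x m]. cbn [fst snd]. intros Hm.
  apply Nat.eqb_neq in Hm. rewrite Hm. cbv zeta.
  destruct (dec (flowering A _ /\ Nat.Odd m /\ rank A _ = m)) eqn:E.
  - rewrite dec_true in E. split; [discriminate | lia].
  - destruct (dec (_ /\ _ /\ _ /\ _)) eqn:E'.
    + rewrite dec_true in E'. tauto.
    + rewrite dec_false in E'. split; [discriminate | tauto].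
Qed.

Lemma spawned_finite A M r :
  ~ inf_often (fun k => spawned A M r k = true) <->
  exists N, forall x, start A r x -> length x <= N.
Proof.
  split.
  - intros Hi. apply not_inf_often in Hi as [K HK].
    destruct (bounded_on_initial (fun k => length (fst (decode k))) K) as [D HD].
    exists D. intros x Hx. specialize (HD (encode x 0)). rewrite decode_encode in HD.
    apply HD. destruct (le_gt_dec (encode x 0) K) as [|Hk]; auto. exfalso.
    apply (HK (encode x 0)); [lia|]. apply dec_true. rewrite decode_encode. simpl. split; auto. lia.
  - intros [N HN]. destruct (encode_bounded N M) as [K HK]. apply not_inf_often.
    exists (S K). intros k Hk E. apply (proj1 (dec_true _)) in E as [Hs Hm].
    specialize (HK _ _ (HN _ Hs) Hm). rewrite encode_decode in HK. lia.
Qed.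

(** For odd [m], recurrence of the value 1 makes the whole followed path flowering, with rank [m]
    recurring. Acceptance makes the limit superior even, hence larger than [m], and this yields the
    value 2 infinitely often. *)
Lemma accepted_component A t k :
  L A t -> (forall x, productive A (run A t x)) ->
  inf_often (fun n => component A (run A t) k n = 2) \/
  ~ inf_often (fun n => component A (run A t) k n = 1).
Proof.
  intros Ht Hp. destruct (Nat.eq_dec (snd (decode k)) 0) as [Em|Em].
  { apply component_Buechi; auto. apply inf_often_progress_iff. split; auto.
    intros p. apply good_on_accepted_path; auto. }
  apply or_comm, NNPP. intros Hor. apply not_or_and in Hor as [H1 H2]. apply NNPP in H1.
  apply H2. clear H2.
  destruct (follow_path A (run A t) (fst (decode k))) as [p Ep].
  set (l := length (fst (decode k))) in *.
  assert (Hall : forall n, flowering A (run A t (prefix p n))).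
  { intros n. destruct (H1 n) as [n' [Hn E]]. apply component_1 in E as [E _]; auto.
    rewrite <- Ep in E. eapply flowering_prefix; [auto| |exact E]. lia. }
  assert (Hodd : Nat.Odd (snd (decode k))).
  { destruct (H1 0) as [n [_ E]]. apply component_1 in E; tauto. }
  destruct (rank_bounded A) as [M HM].
  destruct (max_inf_exists (fun n => rank A (run A t (prefix p n))) M) as [m Hm]; auto.
  assert (He := proj1 (parity_ok_max_inf _ m Hm) (Ht p)).
  assert (Hle : snd (decode k) <= m).
  { apply (max_inf_top _ _ _ Hm). apply (inf_often_tail (fun n => rank A (run A t (prefix p n)) = _) l).
    revert H1. apply inf_often_impl. intros n E. apply component_1 in E; auto. rewrite Ep. tauto. }
  destruct Hm as [Hi _].
  apply (inf_often_tail (fun n => rank A (run A t (prefix p n)) = m) l) in Hi.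
  revert Hi. apply inf_often_impl. intros n E. apply component_2; auto. cbv zeta.
  rewrite <- Ep, E. repeat split; auto.
  destruct (Nat.eq_dec (snd (decode k)) m) as [Eq|]; [|lia].
  exfalso. rewrite Eq in Hodd. eapply Nat.Even_Odd_False; eauto.
Qed.

(** * Acceptance recovered from the components *)

(** Some recurring good state is not flowering, so its rank is the maximum of an even loop on it.
    Were the limit superior odd, the path would close a loop of that larger odd rank on the same
    state and complete a flower. *)
Lemma nonflowering_path_accepted A t p n :
  (forall x, productive A (run A t x)) ->
  inf_often (fun n => good A (run A t (prefix p n))) ->
  ~ flowering A (run A t (prefix p n)) ->
  parity_ok (fun n => rank A (run A t (prefix p n))).
Proof.
  intros Hp Hg Hn. destruct (inf_often_state A (fun n => run A t (prefix p n)) _ Hg) as [q Hq].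
  assert (Hnq : ~ flowering A q).
  { destruct (Hq n) as [k [Hk [_ <-]]]. intros Hf. apply Hn. eapply flowering_prefix; eauto. }
  destruct (rank_bounded A) as [M HM].
  destruct (max_inf_exists (fun n => rank A (run A t (prefix p n))) M) as [m Hm]; auto.
  apply (parity_ok_max_inf _ m Hm).
  destruct (Nat.Even_or_Odd m) as [|Hodd]; auto. exfalso. apply Hnq.
  destruct Hm as [Hi [N HN]].
  destruct (Hq N) as [i [Hi1 [Hi2 Hi3]]].
  rewrite Hi3 in Hi2. destruct Hi2 as [|[Heven [w Hw]]]; [contradiction|].
  destruct (Hi (S i)) as [k [Hk1 Hk2]].
  destruct (Hq k) as [j [Hj1 [Hj2 Hj3]]].
  exists []. split; [exact I|]. cbn [walk].
  exists (rank A q), m, w, (segment t p i (j - i)). repeat split; auto.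
  - assert (rank A q <= m) by (rewrite <- Hi3; apply HN; lia).
    destruct (Nat.eq_dec (rank A q) m) as [Eq|]; [|lia].
    exfalso. rewrite Eq in Heven. eapply Nat.Even_Odd_False; eauto.
  - apply Hw.
  - apply Hw.
  - apply Hw.
  - apply Hw.
  - rewrite <- Hi3. now apply live_segment.
  - rewrite <- Hi3, walk_segment. replace (i + (j - i)) with j by lia. congruence.
  - rewrite <- Hi3. apply ranks_segment. exists k. split; [lia | auto].
  - rewrite <- Hi3. intros r Hr. apply ranks_segment in Hr as [n' [Hn' ->]]. apply HN. lia.
Qed.

(** The root is a start and starts have bounded length, so [p] meets a last one. A later right turn
    past a flowering left child would create another start. *)
Lemma path_eventually_followed A t p N :
  (forall n, flowering A (run A t (prefix p n))) ->
  (forall x, start A (run A t) x -> length x <= N) ->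
  exists n0, start A (run A t) (prefix p n0) /\
    forall n, prefix p (n0 + n) = follow A (run A t) (prefix p n0) n.
Proof.
  intros HW HN.
  assert (Hlast : exists n0, start A (run A t) (prefix p n0) /\
            forall n, n0 < n -> ~ start A (run A t) (prefix p n)).
  { assert (H : forall k n, N - n <= k -> start A (run A t) (prefix p n) ->
              exists n0, start A (run A t) (prefix p n0) /\
                forall n, n0 < n -> ~ start A (run A t) (prefix p n)).
    { induction k as [|k IH]; intros n Hk Hn.
      - exists n. split; auto. intros n' Hn' Hs. apply HN in Hs. rewrite prefix_length in Hs. lia.
      - destruct (classic (exists n', n < n' /\ start A (run A t) (prefix p n'))) as [[n' [Hn' Hs]]|Hno].
        + apply (IH n'); auto. lia.
        + exists n. split; auto. intros n' Hn' Hs. eauto. }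
    apply (H N 0); [lia|]. now left. }
  destruct Hlast as [n0 [Hs Hl]]. exists n0. split; auto.
  induction n as [|n IH]; [now rewrite Nat.add_0_r|].
  simpl. rewrite <- IH, Nat.add_succ_r, prefix_S. do 2 f_equal.
  unfold follow_dir. specialize (HW (S (n0 + n))). rewrite prefix_S in HW.
  destruct (p (n0 + n)) eqn:E; symmetry.
  - apply Bool.negb_true_iff, dec_false. intros Hf.
    apply (Hl (S (n0 + n))); [lia|]. right. exists (prefix p (n0 + n)).
    split; [now rewrite prefix_S, E|]. intros [|]; auto.
  - apply Bool.negb_false_iff, dec_true. auto.
Qed.

Lemma reduction_correct A M t :
  ~ replicates_flower A -> (forall q, rank A q <= M) ->
  (L A t <-> L H (reduction A M t)).
Proof.
  intros Hno HM. unfold reduction. rewrite H_code_accepted, spawned_finite. split.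
  - intros Ht. assert (Hp : forall x, productive A (run A t x)).
    { intros x. now apply productive_subtree. }
    split.
    + destruct (accepted_finitely_branching A t Hno Ht) as [N HN]. exists (S N).
      intros x [->|[y [-> Hy]]]; [simpl; lia|]. rewrite length_app. simpl.
      specialize (HN y Hy). lia.
    + intros k _. now apply accepted_component.
  - intros [[N HN] Hc].
    assert (Hroot : start A (run A t) []) by now left.
    (* The root is always a start, so the Buechi condition is always among those imposed. *)
    assert (Hpg := Hc (encode [] 0)). unfold spawned in Hpg.
    rewrite decode_encode, dec_true, component_Buechi in Hpg by now rewrite decode_encode.
    specialize (Hpg (conj Hroot (Nat.le_0_l _))). apply inf_often_progress_iff in Hpg as [Hp Hg].
    intros p. destruct (classic (exists n, ~ flowering A (run A t (prefix p n)))) as [[n Hn]|HW].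
    { now apply (nonflowering_path_accepted A t p n). }
    assert (HW' : forall n, flowering A (run A t (prefix p n))).
    { intros n. apply NNPP. eauto. }
    destruct (path_eventually_followed A t p N HW' HN) as [n0 [Hs Hf]].
    destruct (max_inf_exists (fun n => rank A (run A t (prefix p n))) M) as [m Hm]; auto.
    apply (parity_ok_max_inf _ m Hm).
    destruct (Nat.Even_or_Odd m) as [|Hodd]; auto. exfalso.
    destruct Hm as [Hi [K HK]].
    assert (Hm0 : m <> 0) by (intros ->; destruct Hodd; lia).
    (* The component for the odd limit superior [m] on the path followed from the last start fails:
       1 recurs, while 2 would need a rank above [m]. *)
    specialize (Hc (encode (prefix p n0) m)). unfold spawned in Hc.
    rewrite decode_encode, dec_true in Hc. cbn [fst snd] in Hc.
    destruct Hc as [Hc|Hc].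
    + split; auto. destruct (Hi 0) as [n [_ <-]]. auto.
    + destruct (Hc K) as [n [Hn E]]. apply component_2 in E; rewrite decode_encode in *; auto.
      cbn [fst snd] in E. rewrite <- Hf in E. specialize (HK (n0 + n) ltac:(lia)). lia.
    + apply Hc. apply (inf_often_tail (fun n => rank A (run A t (prefix p n)) = m) n0) in Hi.
      revert Hi. apply inf_often_impl. intros n E.
      apply component_1; rewrite decode_encode; auto. cbn [fst snd]. rewrite <- Hf. auto.
Qed.

Lemma reduces_to_H A : ~ replicates_flower A -> wadge_le (L A) (L H).
Proof.
  intros Hno. destruct (rank_bounded A) as [M HM]. exists (reduction A M). split.
  - apply reduction_continuous.
  - intros t. now apply reduction_correct.
Qed.

Theorem theorem12p4 :
  Delta03 (L H) /\
  (forall A : DPTA, Delta03 (L A) -> wadge_le (L A) (L H)).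
Proof.
  split; [exact (conj L_H_Sigma03 L_H_Pi03)|].
  intros A [HA _]. apply reduces_to_H. intros Hr.
  exact (replicates_flower_not_Sigma03 A Hr HA).
Qed.
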